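(* There exist universal constants $C,C'>0$ such that the following holds. Let $X_1,\dots,X_n$ be an $n$-sample with values in $(\mathcal X,\mathcal A,\mu)$ and density $s$ with respect to $\mu$. Let $\overline S$ be a model of densities on $(\mathcal X,\mathcal A,\mu)$ for which there exists a countable identifiable subset $S$ of $\overline S$ with the following properties. (i) For all densities $s$ on $(\mathcal X,\mathcal A,\mu)$, $K(s,S)=K(s,\overline S)$. (ii) For all $\sigma>0$ and $\overline s\in S$ there exist a non-increasing mapping $z\mapsto\mathcal H^S_{[\,]}(\overline s,\sigma,z)$ from $(0,+\infty)$ into $(0,+\infty)$ and a family $\mathcal I(\overline s,\sigma,z)$ of pairs of non-negative measurable functions on $(\mathcal X,\mathcal A,\mu)$ such that $\log2\le\log|\mathcal I(\overline s,\sigma,z)|\le\mathcal H^S_{[\,]}(\overline s,\sigma,z)$ for all $z>0$. Moreover, for all $t\in S$ with $h(\overline s,t)\le\sigma$ one can find a pair $(t_L,t_U)\in\mathcal I(\overline s,\sigma,z)$ such that $t_L\le t\le t_U$ and $\frac12\int(\sqrt{t_U}-\sqrt{t_L})^2d\mu\le z^2$. (iii) There exists a non-decreasing function $\phi$ from $(0,+\infty)$ into $(0,+\infty)$ such that $x\mapsto\phi(x)/x$ is non-increasing on $(0,+\infty)$ and $\sup_{\overline s\in S}\int_0^\sigma\sqrt{\mathcal H^S_{[\,]}(\overline s,\sigma,z)}\,dz\le\phi(\sigma)$ for all $\sigma>0$. Let $\tau_n=\inf\{\sigma>0:\phi(\sigma)\le\sqrt n\,\sigma^2\}$. Then $$d(S)=\sup_{\overline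 s\in S}D^S(\overline{\mathbf s},\overline{\mathbf s})\le(Cn\tau_n^2)\vee1$$ and, for any $\rho$-estimator $\widehat s$ of $s$ based on $S$, $$C'\,\mathbb E_{\mathbf s}\big[h^2(s,\widehat s)\big]\le K(s,\overline S)+\tau_n^2\vee n^{-1}.$$
   Context: Density framework: $n\ge3$; $X_1,\dots,X_n$ are i.i.d. with density $s$ with respect to $\mu$; a density $t$ is identified with $\mathbf t=(t,\dots,t)$ ($n$ copies) and $\boldsymbol X=(X_1,\dots,X_n)$; $\mathbb E_{\mathbf s}$ is the expectation when the $X_i$ have density $s$. $h^2(t,t')=\frac12\int(\sqrt t-\sqrt{t'})^2d\mu$, $\rho(t,t')=\int\sqrt{tt'}\,d\mu$. A model is a nonempty set of densities separable for $h$. $S$ is identifiable if $h(t,t')>0$ for distinct $t,t'\in S$. $K(s,t)=\int s\log(s/t)\,d\mu\in[0,+\infty]$ is the Kullback-Leibler divergence between $s\cdot\mu$ and $t\cdot\mu$ ($+\infty$ if $s\cdot\mu\not\ll t\cdot\mu$) and $K(s,S)=\inf_{t\in S}K(s,t)$. Conventions: $0/0=1$, $x/0=+\infty$ for $x>0$, $\sup\varnothing=0$. Constants: $c_0=\frac18(1-\frac1{\sqrt2})$, $\kappa=357$. $\rho$-estimators. $\psi(u)=\frac{u-1}{\sqrt{1+u^2}}$ for $u\in[0,+\infty)$, $\psi(+\infty)=1$. For densities $t,t'$ and $r=(t+t')/2$, $\mathbf T(\boldsymbol X,\mathbf t,\mathbf t')=\frac n2[\rho(t',r)-\rho(t,r)]+\frac1{\sqrt2}\sum_{i=1}^n\psi(\sqrt{t'/t}(X_i))$;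 $\boldsymbol\Upsilon(S,\mathbf t)=\sup_{t'\in S}\mathbf T(\boldsymbol X,\mathbf t,\mathbf t')$; $\mathcal E(\boldsymbol X,S)=\{t\in S:\boldsymbol\Upsilon(S,\mathbf t)\le\inf_{u\in S}\boldsymbol\Upsilon(S,\mathbf u)+\kappa/10\}$. A $\rho$-estimator based on $S$ is any measurably chosen element $\widehat s=\widehat s(\boldsymbol X)$ of the closure (densities at Hellinger distance $0$) of $\mathcal E(\boldsymbol X,S)$. Dimension. For densities $s,\overline s$ and $y\ge0$, let $\mathcal B^S(\mathbf s,\overline{\mathbf s},y)=\{t\in S:nh^2(s,t)+nh^2(s,\overline s)\le y^2\}$, $\mathbf w^S(\mathbf s,\overline{\mathbf s},y)=\mathbb E_{\mathbf s}\big[\sup_{t\in\mathcal B^S(\mathbf s,\overline{\mathbf s},y)}\big|\sum_{i=1}^n\{\psi(\sqrt{t/\overline s}(X_i))-\mathbb E_{\mathbf s}[\psi(\sqrt{t/\overline s}(X_i))]\}\big|\big]$ ($0$ if the set is empty), and $D^S(\mathbf s,\overline{\mathbf s})=\overline y^2\vee1$ with $\overline y=\sup\{y\ge0:\mathbf w^S(\mathbf s,\overline{\mathbf s},y)>c_0y^2\}$. *)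

(* Defs.v *)
From HB Require Import structures.
From mathcomp Require Import all_boot all_order all_algebra.
From mathcomp Require Import all_classical all_reals all_analysis.
From mathcomp Require Import measurable_realfun.

Set Implicit Arguments.
Unset Strict Implicit.
Unset Printing Implicit Defensive.

Import Order.TTheory GRing.Theory Num.Theory.
Import numFieldNormedType.Exports.

Local Open Scope classical_set_scope.
Local Open Scope ring_scope.

(* Supremum, in [0, +oo], of a set of nonnegative extended reals, with the
   convention sup set0 = 0 (ereal_sup set0 is -oo). *)
Definition nnsup (R : realType) (A : set (\bar R)) : \bar R :=
  ereal_sup (0%E |` A).

(* Densities are genuine functions: two densities that agree mu-almost
   everywhere are at Hellinger distance 0 but need not be equal. *)
Record density (d : measure_display) (T : measurableType d) (R : realType)
    (mu : {measure set T -> \bar R}) := Density {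
  density_fun :> T -> R ;
  density_measurable : measurable_fun [set: T] density_fun ;
  density_ge0 : forall x, 0 <= density_fun x ;
  density_int1 : (\int[mu]_x (density_fun x)%:E = 1)%E }.

Section density_law.
Local Open Scope ereal_scope.
Context (d : measure_display) (T : measurableType d) (R : realType)
  (mu : {measure set T -> \bar R}).

Definition density_law (s : density mu) : set T -> \bar R :=
  fun A => \int[mu]_(x in A) (s x)%:E.

Variable s : density mu.

Let law0 : density_law s set0 = 0.
Proof. by rewrite /density_law integral_set0. Qed.

Let law_ge0 A : 0 <= density_law s A.
Proof.
by rewrite /density_law integral_ge0// => x _; rewrite lee_fin density_ge0.
Qed.

Let law_sigma_additive : semi_sigma_additive (density_law s).
Proof.
move=> /= F mF tF mUF; rewrite /density_law ge0_integral_bigcup//=.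
- apply: is_cvg_ereal_nneg_natsum_cond => n _ _.
  by apply: integral_ge0 => x _; rewrite lee_fin density_ge0.
- apply: (measurable_funS _ (@subsetT _ _)) => //.
  by apply/measurable_EFinP; exact: density_measurable.
- by move=> x _; rewrite lee_fin density_ge0.
Qed.

HB.instance Definition _ := isMeasure.Build _ _ _
  (density_law s) law0 law_ge0 law_sigma_additive.

Let law_setT : density_law s [set: T] = 1.
Proof. exact: density_int1. Qed.

HB.instance Definition _ :=
  Measure_isProbability.Build _ _ _ (density_law s) law_setT.

End density_law.

Section product_law.
Context (d : measure_display) (T : measurableType d) (R : realType).

Definition tuple_cons (n : nat) (p : T * n.-tuple T) : n.+1.-tuple T :=
  [tuple of p.1 :: p.2].

Let measurable_tuple_cons n : measurable_fun setT (@tuple_cons n).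
Proof.
by apply: (measurable_cons measurable_fst measurable_snd).
Qed.

HB.instance Definition _ n := isMeasurableFun.Build _ _ _ _
  (@tuple_cons n) (@measurable_tuple_cons n).

(* The n-fold product P \x ... \x P on the product sigma-algebra of T ^ n. *)
Fixpoint prob_pow (P : probability T R) (n : nat) :
    probability (n.-tuple T) R :=
  match n with
  | 0%N => dirac [tuple]
  | m.+1 => distribution (P \x prob_pow P m)%E (@tuple_cons m)
  end.

End product_law.

Section rho_estimation.
Context (d : measure_display) (T : measurableType d) (R : realType)
  (mu : {measure set T -> \bar R}).
Implicit Types (s t : density mu) (S A : set (density mu)) (n : nat).

(* Law of n i.i.d. observations with density s. *)
Definition iid_law s n : probability (n.-tuple T) R :=
  prob_pow (density_law s) n.

Definition is_iid_sample (dO : measure_display) (O : measurableType dO)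
    (P : probability O R) n (X : 'I_n -> {RV P >-> T}) s : Prop :=
  (forall i B, measurable B -> distribution P (X i) B = density_law s B) /\
  (forall B : 'I_n -> set T, (forall i, measurable (B i)) ->
     P (\bigcap_i (X i @^-1` B i)) = (\prod_(i < n) P (X i @^-1` B i))%E).

(* Extended-real valued and defined for arbitrary functions, since the
   integral can be infinite for the two ends of a bracket. *)
Definition hellinger_sq (f g : T -> R) : \bar R :=
  ((2^-1)%:E * \int[mu]_x ((Num.sqrt (f x) - Num.sqrt (g x)) ^+ 2)%:E)%E.

Definition hellinger s t : R := Num.sqrt (fine (hellinger_sq s t)).

Definition affinity (f g : T -> R) : R :=
  \int[mu]_x Num.sqrt (f x * g x).

(* On the null set where t vanishes but s does not, the value of the integrand
   (0, as x / 0 = 0 in R) is irrelevant. *)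
Definition kullback s t : \bar R :=
  if `[< density_law s `<< density_law t >]
  then (\int[mu]_x (s x * ln (s x / t x))%:E)%E else +oo%E.

Definition kullback_set s S : \bar R :=
  ereal_inf [set kullback s t | t in S].

Definition hellinger_separable S : Prop :=
  exists2 Q : set (density mu), Q `<=` S & countable Q /\
    forall t, S t -> forall e : R, 0 < e ->
      exists2 u, Q u & hellinger t u < e.

Definition is_model S : Prop := S !=set0 /\ hellinger_separable S.

Definition identifiable S : Prop :=
  forall t t', S t -> S t' -> t <> t' -> 0 < hellinger t t'.

Definition hellinger_closure A : set (density mu) :=
  [set t | forall e : R, 0 < e -> exists2 u, A u & hellinger t u < e].

(* sqrt (t' / t) with 0 / 0 = 1 and x / 0 = +oo for x > 0. *)
Definition root_ratio (t' t : T -> R) (x : T) : \bar R :=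
  if t x == 0 then (if t' x == 0 then 1%E else +oo%E)
  else (Num.sqrt (t' x / t x))%:E.

(* Only used on [0, +oo]. *)
Definition psi (u : \bar R) : R :=
  match u with
  | r%:E => (r - 1) / Num.sqrt (1 + r ^+ 2)
  | +oo%E => 1
  | -oo%E => -1
  end.

Definition kappa : R := 357.
Definition c0 : R := 8^-1 * (1 - (Num.sqrt 2)^-1).

Definition Tstat n (x : n.-tuple T) t t' : R :=
  let r := fun z => (t z + t' z) / 2 in
  n%:R / 2 * (affinity t' r - affinity t r)
  + (Num.sqrt 2)^-1 * \sum_(i < n) psi (root_ratio t' t (tnth x i)).

Definition Upsilon n (x : n.-tuple T) S t : \bar R :=
  ereal_sup [set (Tstat x t t')%:E | t' in S].

Definition rho_set n (x : n.-tuple T) S : set (density mu) :=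
  [set t | S t /\
    (Upsilon x S t <= ereal_inf [set Upsilon x S u | u in S]
                      + (kappa / 10)%:E)%E].

(* Measurability is with respect to the sigma-algebra on densities generated
   by the Hellinger distances to fixed densities. *)
Definition rho_estimator n S (shat : n.-tuple T -> density mu) : Prop :=
  (forall u, measurable_fun setT (fun x => hellinger u (shat x))) /\
  (forall x, hellinger_closure (rho_set x S) (shat x)).

Definition dim_ball n S s sbar (y : R) : set (density mu) :=
  [set t | S t /\
    n%:R * hellinger s t ^+ 2 + n%:R * hellinger s sbar ^+ 2 <= y ^+ 2].

Definition dim_w n S s sbar (y : R) : \bar R :=
  (\int[iid_law s n]_x nnsup [set
     (`| \sum_(i < n) (psi (root_ratio t sbar (tnth x i))
           - fine 'E_(iid_law s n)[fun z => psi (root_ratio t sbar (tnth z i))])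
      |)%:E | t in dim_ball n S s sbar y])%E.

Definition dim_ybar n S s sbar : \bar R :=
  nnsup [set y%:E | y in
    [set y : R | 0 <= y /\ ((c0 * y ^+ 2)%:E < dim_w n S s sbar y)%E]].

Definition rho_dim n S s sbar : \bar R :=
  maxe (dim_ybar n S s sbar ^+ 2)%E 1%E.

End rho_estimation.

(* Main.v *)
Require Import Defs.
From HB Require Import structures.
From mathcomp Require Import all_boot all_order all_algebra.
From mathcomp Require Import all_classical all_reals all_analysis.
From mathcomp Require Import measurable_realfun.
From mathcomp Require Import ring lra.

Set Implicit Arguments.
Unset Strict Implicit.
Unset Printing Implicit Defensive.

Import Order.TTheory GRing.Theory Num.Theory.
Import numFieldNormedType.Exports.

Local Open Scope classical_set_scope.
Local Open Scope ring_scope.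

(* Everything is reduced to exponential moments under the well-specified law
   t ^ n, t in S. Writing sqrt-ratios in closed form, T(X, t, u) is at most
   - n h^2(t, u) / 4 + Z_u / sqrt 2, where Z_u is the centered sum of
   psi (sqrt (u / t)); since T is antisymmetric, a rho-estimator shat satisfies
   n h^2(t, shat) <= C (sup_u (|Z_u| - eps n h^2(t, u)) + 1). Chaining with
   brackets and truncation bounds E exp (lambda (|Z_u| - eps n sigma^2)),
   uniformly over h(t, u) <= sigma, as soon as phi sigma <= alpha sqrt n sigma^2;
   this yields the bound on D^S by Jensen's inequality, and by peeling an
   exponential moment of order 1 for the weighted supremum. The passage from
   t ^ n to the true law s ^ n is the Donsker-Varadhan inequality
   E_s [ln V] <= n K(s, t) + ln E_t [V], and 2 h^2(s, t) <= K(s, t). *)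

(** * Integration *)

(** The detour through [t ^ n] is dictated by the score. As a function of [sqrt u],
    [psi (sqrt (u / t))] varies at a rate of order [1 / sqrt t], so Hellinger brackets control its
    increments in mean square when the observations have density [t] itself: the weight [t] then
    cancels the singularity ([score_lipschitz]). Under another law [s] this cancellation is lost.
    The change of law, in turn, only transfers expectations of logarithms, so deviations have to be
    stated as exponential moments and not merely as means. Suprema over [S] are integrated only
    through bounded measurable majorants: [W], of mean at most 1, for a ball, and [V], of mean at
    most 2, after peeling, with [V >= 1] so that [ln V] is nonnegative. *)

Lemma ge0_le_integralT (d : measure_display) (T : measurableType d)
    (R : realType) (mu : {measure set T -> \bar R}) (f g : T -> \bar R) :
  (forall x, 0 <= f x)%E -> (forall x, f x <= g x)%E ->
  (\int[mu]_x f x <= \int[mu]_x g x)%E.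
Proof.
move=> f0 fg; have g0 x : (0 <= g x)%E by exact: le_trans (fg x).
rewrite !ge0_integralTE//; apply: ereal_sup_le => _ [h /= hf <-].
by exists h => // x; exact: le_trans (hf x) (fg x).
Qed.

Section bounded_measurable.
Context (d : measure_display) (T : measurableType d) (R : realType).
Implicit Types (P : probability T R) (f g : T -> R).

(** Such functions are integrable under every probability, so one class serves for real-valued
    integrals under the true law and under the laws of the model alike. *)
Definition bounded_mfun f :=
  measurable_fun setT f /\ exists B, forall x, `|f x| <= B.

Lemma bounded_mfun_cst r : bounded_mfun (fun=> r).
Proof. by split; [exact: measurable_cst|exists `|r|]. Qed.

Lemma bounded_mfunD f g : bounded_mfun f -> bounded_mfun g ->
  bounded_mfun (fun x => f x + g x).
Proof.
move=> [mf [B fB]] [mg [C gC]]; split; first exact: measurable_funD.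
by exists (B + C) => x; rewrite (le_trans (ler_normD _ _))// lerD.
Qed.

Lemma bounded_mfunM f g : bounded_mfun f -> bounded_mfun g ->
  bounded_mfun (fun x => f x * g x).
Proof.
move=> [mf [B fB]] [mg [C gC]]; split; first exact: measurable_funM.
by exists (B * C) => x; rewrite normrM ler_pM.
Qed.

Lemma bounded_mfunN f : bounded_mfun f -> bounded_mfun (fun x => - f x).
Proof.
move=> [mf [B fB]]; split; first exact: measurableT_comp.
by exists B => x; rewrite normrN.
Qed.

Lemma bounded_mfunB f g : bounded_mfun f -> bounded_mfun g ->
  bounded_mfun (fun x => f x - g x).
Proof. by move=> bf /bounded_mfunN; exact: bounded_mfunD. Qed.

Lemma bounded_mfunX f n : bounded_mfun f -> bounded_mfun (fun x => f x ^+ n).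
Proof.
move=> bf; elim: n => [|n IH]; first exact: bounded_mfun_cst.
by under eq_fun do rewrite exprS; exact: bounded_mfunM.
Qed.

Lemma bounded_mfun_sum (I : Type) (r : seq I) (F : I -> T -> R) :
  (forall i, bounded_mfun (F i)) -> bounded_mfun (fun x => \sum_(i <- r) F i x).
Proof.
move=> bF; elim: r => [|i r IH].
  by under eq_fun do rewrite big_nil; exact: bounded_mfun_cst.
by under eq_fun do rewrite big_cons; exact: bounded_mfunD.
Qed.

Lemma bounded_mfun_expR f : bounded_mfun f -> bounded_mfun (fun x => expR (f x)).
Proof.
move=> [mf [B fB]]; split; first exact: measurableT_comp.
exists (expR B) => x; rewrite ger0_norm ?expR_ge0// ler_expR.
exact: le_trans (ler_norm _) (fB x).
Qed.

Lemma bounded_mfun_itv f a b : measurable_fun setT f ->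
  (forall x, a <= f x <= b) -> bounded_mfun f.
Proof.
move=> mf fab; split=> //; exists (`|a| + `|b|) => x.
have /andP[af fb] := fab x; rewrite ler_norml; apply/andP; split.
- have := ler_norm (- a); have := normr_ge0 b; rewrite normrN; lra.
- have := ler_norm b; have := normr_ge0 a; lra.
Qed.

Lemma bounded_mfun_ln f b : measurable_fun setT f ->
  (forall x, 1 <= f x <= b) -> bounded_mfun (fun x => ln (f x)).
Proof.
move=> mf f1b; apply: (@bounded_mfun_itv _ 0 (ln b)).
  by apply: (measurableT_comp _ mf); exact: measurable_ln.
move=> x; have /andP[f1 fb] := f1b x; have f0 := lt_le_trans ltr01 f1.
by rewrite ln_ge0//= ler_ln// posrE (lt_le_trans f0).
Qed.

Lemma integral_prob_cst P r : (\int[P]_x r%:E)%E = r%:E.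
Proof. by have := expectation_cst P r; rewrite unlock. Qed.

Lemma bounded_mfun_integrable P f :
  bounded_mfun f -> P.-integrable setT (EFin \o f).
Proof.
move=> [mf [B fB]]; apply: (@le_integrable _ _ _ _ _ _ _ (EFin \o cst `|B|)) => //.
- by apply/measurable_EFinP.
- move=> x _ /=; rewrite lee_fin normr_id.
  exact: le_trans (fB x) (ler_norm _).
- exact: finite_measure_integrable_cst.
Qed.

Lemma Rintegral_boundedE P f : bounded_mfun f ->
  (\int[P]_x f x)%:E = (\int[P]_x (f x)%:E)%E.
Proof.
by move=> /(bounded_mfun_integrable P) fi; rewrite fineK// integrable_fin_num.
Qed.

Lemma Rintegral_prob_cst P r : \int[P]_x r = r.
Proof. by rewrite /Rintegral integral_prob_cst. Qed.

Lemma Rintegral_boundedD P f g : bounded_mfun f -> bounded_mfun g ->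
  \int[P]_x (f x + g x) = \int[P]_x f x + \int[P]_x g x.
Proof.
by move=> bf bg; apply: RintegralD => //; exact: bounded_mfun_integrable.
Qed.

Lemma Rintegral_boundedZ P f r : bounded_mfun f ->
  \int[P]_x (r * f x) = r * \int[P]_x f x.
Proof.
by move=> bf; apply: RintegralZl => //; exact: bounded_mfun_integrable.
Qed.

Lemma Rintegral_boundedB P f g : bounded_mfun f -> bounded_mfun g ->
  \int[P]_x (f x - g x) = \int[P]_x f x - \int[P]_x g x.
Proof.
by move=> bf bg; apply: RintegralB => //; exact: bounded_mfun_integrable.
Qed.

Lemma le_Rintegral_bounded P f g : bounded_mfun f -> bounded_mfun g ->
  (forall x, f x <= g x) -> \int[P]_x f x <= \int[P]_x g x.
Proof.
move=> bf bg fg.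
by apply: le_Rintegral => //; exact: bounded_mfun_integrable.
Qed.

End bounded_measurable.

(** * Integration against the law of a density and against product laws *)

Section density_integral.
Context (d : measure_display) (T : measurableType d) (R : realType)
  (mu : {measure set T -> \bar R}) (s : density mu).

Let ms : measurable_fun setT (EFin \o s).
Proof. by apply/measurable_EFinP; exact: density_measurable. Qed.

Let s0 x : (0 <= (s x)%:E)%E.
Proof. by rewrite lee_fin density_ge0. Qed.

Import HBNNSimple.

(** [mu] may fail to be sigma-finite, so the formula is derived from simple functions by monotone
    convergence and not from Radon-Nikodym derivatives. *)
Lemma ge0_integral_density_law (f : T -> \bar R) :
  measurable_fun setT f -> (forall x, 0 <= f x)%E ->
  (\int[density_law s]_x f x = \int[mu]_x (f x * (s x)%:E))%E.
Proof.
move=> mf f0; pose f_ := nnsfun_approx measurableT mf.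
have fE x : f x = limn (fun n => (f_ n x)%:E).
  by apply/esym/cvg_lim => //; exact: cvg_nnsfun_approx.
transitivity (limn (fun n => \int[density_law s]_x (f_ n x)%:E)%E).
  rewrite -monotone_convergence//.
  - by apply: eq_integral => x _; exact: fE.
  - by move=> n; apply/measurable_EFinP.
  - by move=> n x _; rewrite lee_fin.
  - by move=> x _ a b ab; rewrite lee_fin; exact/lefP/nd_nnsfun_approx.
transitivity (limn (fun n => \int[mu]_x ((f_ n x)%:E * (s x)%:E))%E); last first.
  rewrite -monotone_convergence//.
  - apply: eq_integral => x _; apply/cvg_lim => //.
    apply: cvgeZr => //; exact: cvg_nnsfun_approx.
  - by move=> n; apply: emeasurable_funM => //; apply/measurable_EFinP.
  - by move=> n x _; rewrite mule_ge0// lee_fin.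
  - move=> x _ a b ab; rewrite lee_wpmul2r// lee_fin.
    exact/lefP/nd_nnsfun_approx.
congr (limn _); apply/funext => n.
have Eh x : (f_ n x)%:E = (\sum_(r \in range (f_ n)) (r * \1_(f_ n @^-1` [set r]) x)%:E)%E.
  by rewrite fsumEFin// -fimfunE.
under [LHS]eq_integral do rewrite Eh.
rewrite ge0_integral_fsum//; last 2 first.
  - move=> r; apply/measurable_EFinP; exact: measurable_funM.
  - by move=> r x _; rewrite nnfun_muleindic_ge0.
under [in RHS]eq_integral => x _.
  rewrite Eh ge0_mule_fsuml; last by move=> r; rewrite nnfun_muleindic_ge0.
  over.
rewrite ge0_integral_fsum//; last 2 first.
  - move=> r; apply: emeasurable_funM => //; apply/measurable_EFinP.
    exact: measurable_funM.
  - by move=> r x _; rewrite mule_ge0// nnfun_muleindic_ge0.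
apply: eq_fsbigr => r /[!inE] -[x0 _ <-].
have k0 : 0 <= f_ n x0 by [].
set A := _ @^-1` _.
have mA : measurable A by exact: measurable_funPTI.
under [LHS]eq_integral do rewrite EFinM.
rewrite ge0_integralZl_EFin//; last first.
  by apply/measurable_EFinP; exact: measurable_indic.
under [in RHS]eq_integral do rewrite EFinM -muleA.
rewrite ge0_integralZl_EFin//; last 2 first.
  - by move=> x _; rewrite mule_ge0// lee_fin.
  - by apply: emeasurable_funM => //; apply/measurable_EFinP; exact: measurable_indic.
congr (_ * _)%E; rewrite integral_indic// setIT /= /density_law.
rewrite integral_mkcond; apply: eq_integral => x _.
rewrite patchE indicE; case: ifPn => _; by rewrite ?mul1e ?mul0e.
Qed.

Lemma integral_density_law (f : T -> R) : measurable_fun setT f ->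
  (\int[density_law s]_x (f x)%:E = \int[mu]_x (f x * s x)%:E)%E.
Proof.
move=> mf; have mfE : measurable_fun setT (EFin \o f) by apply/measurable_EFinP.
rewrite [LHS]integralE [RHS]integralE.
rewrite ge0_integral_density_law//; last exact: measurable_funepos.
rewrite ge0_integral_density_law//; last exact: measurable_funeneg.
congr (_ - _)%E; apply: eq_integral => x _.
- by rewrite !funeposE -!EFin_max -EFinM maxr_pMl ?density_ge0// mul0r.
- by rewrite !funenegE -!EFinN -!EFin_max -EFinM maxr_pMl ?density_ge0// mul0r mulNr.
Qed.

End density_integral.

Section prob_pow_integral.
Context (d : measure_display) (T : measurableType d) (R : realType).
Implicit Types P Q : probability T R.

Lemma ge0_integral_prob_powS P m (F : m.+1.-tuple T -> \bar R) :
  measurable_fun setT F -> (forall x, 0 <= F x)%E ->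
  (\int[prob_pow P m.+1]_z F z =
   \int[P]_x \int[prob_pow P m]_y F (tuple_cons (x, y)))%E.
Proof.
move=> mF F0 /=; rewrite ge0_integral_distribution//.
rewrite fubini_tonelli1//.
  exact: measurableT_comp.
by move=> x; exact: F0.
Qed.

Lemma measurable_integral_prob_pow P m (F : m.+1.-tuple T -> \bar R) :
  measurable_fun setT F -> (forall x, 0 <= F x)%E ->
  measurable_fun setT (fun x => \int[prob_pow P m]_y F (tuple_cons (x, y)))%E.
Proof.
move=> mF F0.
apply: (@measurable_fun_fubini_tonelli_F _ _ _ _ _ (prob_pow P m)
  (F \o (@tuple_cons _ T m))) => //.
  exact: measurableT_comp.
by move=> x /=; exact: F0.
Qed.

Lemma measurable_tuple_cons1 m (x : T) :
  measurable_fun setT (fun y : m.-tuple T => tuple_cons (x, y)).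
Proof. 
exact: (measurable_cons (measurable_cst _) (@measurable_id _ _ _)).
Qed.

Lemma ge0_integral_prob_pow_prod P m (g : 'I_m -> T -> R) :
  (forall i, measurable_fun setT (g i)) -> (forall i x, 0 <= g i x) ->
  (\int[prob_pow P m]_z (\prod_(i < m) g i (tnth z i))%:E =
   \prod_(i < m) \int[P]_x (g i x)%:E)%E.
Proof.
elim: m g => [|m IH] g mg g0.
  rewrite big_ord0; under eq_integral do rewrite big_ord0.
  by rewrite integral_prob_cst.
have mG k (h : 'I_k -> T -> R) : (forall i, measurable_fun setT (h i)) ->
    measurable_fun setT (fun z : k.-tuple T => \prod_(i < k) h i (tnth z i)).
  move=> mh; apply: measurable_prod => i _.
  by apply: measurableT_comp => //; exact: measurable_tnth.
rewrite ge0_integral_prob_powS; last 2 first.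
  - by apply/measurable_EFinP; exact: mG.
  - by move=> z; rewrite lee_fin prodr_ge0.
rewrite big_ord_recl.
have E x : (\int[prob_pow P m]_y
    (\prod_(i < m.+1) g i (tnth (tuple_cons (x, y)) i))%:E =
    (g ord0 x)%:E * \prod_(i < m) \int[P]_x (g (lift ord0 i) x)%:E)%E.
  rewrite -(IH (fun i => g (lift ord0 i)))//.
  rewrite -ge0_integralZl_EFin//; last 2 first.
  - by move=> y _; rewrite lee_fin prodr_ge0.
  - by apply/measurable_EFinP; exact: (mG m (fun i => g (lift ord0 i))).
  apply: eq_integral => y _; rewrite big_ord_recl -EFinM; congr (_ * _)%:E.
  by apply: eq_bigr => i _; rewrite (tnthS x).
under eq_integral do rewrite E.
rewrite /= ge0_integralZr//.
- by apply/measurable_EFinP; exact: mg.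
- by move=> x _; rewrite lee_fin.
- by apply: prode_ge0 => i _; apply: integral_ge0 => x _; rewrite lee_fin.
Qed.

Lemma ge0_integral_prob_pow_tnth P m (g : T -> R) (i : 'I_m) :
  measurable_fun setT g -> (forall x, 0 <= g x) ->
  (\int[prob_pow P m]_z (g (tnth z i))%:E = \int[P]_x (g x)%:E)%E.
Proof.
move=> mg g0; pose h j := if j == i then g else cst 1.
have E := @ge0_integral_prob_pow_prod P m h.
transitivity (\int[prob_pow P m]_z (\prod_(j < m) h j (tnth z j))%:E)%E.
  apply: eq_integral => z _; rewrite (bigD1 i)//= /h eqxx big1 ?mulr1// => j ji.
  by rewrite (negbTE ji).
rewrite E.
- rewrite (bigD1 i)//= {1}/h eqxx big1 ?mule1// => j ji.
  by rewrite /h (negbTE ji) /= integral_prob_cst.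
- by move=> j; rewrite /h; case: ifP.
- by move=> j x; rewrite /h; case: ifP.
Qed.

End prob_pow_integral.

Section donsker_varadhan.
Context (d : measure_display) (T : measurableType d) (R : realType).
Variables (P Q : probability T R) (k : R).

(* Tensorisation of the entropy inequality: integrate out one coordinate at a
   time. *)
Lemma entropy_ineq_prob_pow :
  (forall (V : T -> R) B, measurable_fun setT V -> (forall x, 1 <= V x <= B) ->
    (\int[P]_x (ln (V x))%:E <= (k + ln (\int[Q]_x V x))%:E)%E) ->
  forall m (V : m.-tuple T -> R) B, measurable_fun setT V ->
    (forall x, 1 <= V x <= B) ->
    (\int[prob_pow P m]_x (ln (V x))%:E <=
       (k *+ m + ln (\int[prob_pow Q m]_x V x))%:E)%E.
Proof.
move=> PQ; elim=> [|m IH] V B mV V1B.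
  have V0 x : V x = V [tuple] by rewrite (tuple0 x).
  under eq_integral do rewrite V0.
  under eq_Rintegral do rewrite V0.
  by rewrite integral_prob_cst Rintegral_prob_cst mulr0n add0r.
(* [1 <= V] makes [ln V] nonnegative, as Tonelli's formula for iterated integrals requires. *)
have ln0 x : (0 <= (ln (V x))%:E)%E.
  by rewrite lee_fin ln_ge0//; have /andP[] := V1B x.
have mlnV : measurable_fun setT (fun x => (ln (V x))%:E).
  by apply/measurable_EFinP; apply: measurableT_comp => //; exact: measurable_ln.
have mVx x : measurable_fun setT (fun y : m.-tuple T => V (tuple_cons (x, y))).
  by apply: (measurableT_comp mV); exact: measurable_tuple_cons1.
pose V1 x := \int[prob_pow Q m]_y V (tuple_cons (x, y)).
have bVx x : bounded_mfun (fun y : m.-tuple T => V (tuple_cons (x, y))).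
  by apply: (bounded_mfun_itv (mVx x)) => y; exact: V1B.
have V1E x : (V1 x)%:E = (\int[prob_pow Q m]_y (V (tuple_cons (x, y)))%:E)%E.
  exact: Rintegral_boundedE.
have V0 x : (0 <= (V x)%:E)%E.
  by rewrite lee_fin (le_trans ler01)//; have /andP[] := V1B x.
have mVE : measurable_fun setT (fun x => (V x)%:E) by apply/measurable_EFinP.
have mV1 : measurable_fun setT V1.
  apply/measurable_EFinP; rewrite (_ : _ \o _ = fun x =>
    (\int[prob_pow Q m]_y (V (tuple_cons (x, y)))%:E)%E); last first.
    by apply/funext => x /=; exact: V1E.
  exact: (measurable_integral_prob_pow _ mVE).
have V1b x : 1 <= V1 x <= B.
  rewrite -[1](Rintegral_prob_cst (prob_pow Q m)).
  rewrite -[B](Rintegral_prob_cst (prob_pow Q m)).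
  apply/andP; split; apply: le_Rintegral_bounded => //;
    try exact: bounded_mfun_cst.
  - by move=> y; have /andP[] := V1B (tuple_cons (x, y)).
  - by move=> y; have /andP[] := V1B (tuple_cons (x, y)).
have E : \int[prob_pow Q m.+1]_x V x = \int[Q]_x V1 x.
  apply: EFin_inj; rewrite Rintegral_boundedE; last exact: bounded_mfun_itv V1B.
  rewrite Rintegral_boundedE; last exact: bounded_mfun_itv V1b.
  by rewrite ge0_integral_prob_powS//; apply: eq_integral => x _; rewrite V1E.
rewrite ge0_integral_prob_powS// E.
(* With the first coordinate fixed, the induction hypothesis bounds the inner integral; the
   one-coordinate inequality is then applied to [V1], which inherits the bounds 1 and [B]. *)
apply: (@le_trans _ _ (\int[P]_x (k *+ m + ln (V1 x))%:E)%E).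
  apply: ge0_le_integralT => x; first exact: integral_ge0.
  by apply: (IH _ B) => // y; exact: V1B.
have bln : bounded_mfun (fun x => ln (V1 x)) by exact: bounded_mfun_ln V1b.
rewrite -Rintegral_boundedE; last first.
  by apply: bounded_mfunD => //; exact: bounded_mfun_cst.
rewrite Rintegral_boundedD//; last exact: bounded_mfun_cst.
rewrite Rintegral_prob_cst mulrS lee_fin -addrA [k + _]addrC -addrA lerD2l addrC.
by rewrite -lee_fin Rintegral_boundedE//; exact: PQ V1b.
Qed.

End donsker_varadhan.

(** * From an i.i.d. sample on an abstract probability space to the product law *)

Section sample_law.
Context (d dO : measure_display) (T : measurableType d) (Om : measurableType dO)
  (R : realType) (mu : {measure set T -> \bar R}).
Variables (P : probability Om R) (n : nat) (X : 'I_n -> {RV P >-> T})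
  (s : density mu).

Definition sample_tuple (w : Om) : n.-tuple T := [tuple X i w | i < n].

Lemma measurable_sample_tuple : measurable_fun setT sample_tuple.
Proof.
apply/measurable_fun_tnthP => i.
rewrite (_ : _ \o _ = X i)//; apply/funext => w /=.
by rewrite tnth_mktuple.
Qed.

HB.instance Definition _ := isMeasurableFun.Build _ _ _ _
  sample_tuple measurable_sample_tuple.

(** A pi-system generating the product sigma-algebra, on which independence and the common marginal
    determine the law of the sample. *)
Definition rectangles : set (set (n.-tuple T)) :=
  [set A | exists2 B : 'I_n -> set T, (forall i, measurable (B i)) &
     A = \bigcap_i [set x | B i (tnth x i)]].

Lemma measurable_rectangles :
  (measurable : set (set (n.-tuple T))) = <<s rectangles >>.
Proof.
apply/seteqP; split.
- apply: smallest_sub; first exact: smallest_sigma_algebra.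
  move=> A; rewrite -bigcup_seq => -[i _ [B mB <-]].
  apply: sub_sigma_algebra; exists (fun j => if j == i then B else setT).
    by move=> j; case: ifP.
  apply/seteqP; split=> x /=.
    by move=> [_ Bx] j _ /=; case: eqVneq => [->|].
  by move=> /(_ i Logic.I) /=; rewrite eqxx.
- apply: smallest_sub; first exact: sigma_algebra_measurable.
  move=> _ [B mB ->]; apply: fin_bigcap_measurable => // i _.
  rewrite -[X in measurable X]setTI; apply: measurable_tnth => //.
Qed.

Lemma iid_law_rectangle (B : 'I_n -> set T) : (forall i, measurable (B i)) ->
  iid_law s n (\bigcap_i [set x | B i (tnth x i)]) =
  (\prod_(i < n) density_law s (B i))%E.
Proof.
move=> mB.
have mR : measurable (\bigcap_i [set x : n.-tuple T | B i (tnth x i)]).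
  by rewrite measurable_rectangles; apply: sub_sigma_algebra; exists B.
have := @integral_indic _ _ _ (iid_law s n) _ measurableT _ mR.
rewrite setIT => <-.
transitivity (\int[iid_law s n]_x (\prod_(i < n) \1_(B i) (tnth x i))%:E)%E.
  apply: eq_integral => x _; congr EFin; rewrite indicE.
  have [xB|xB] := boolP (x \in _).
    rewrite big1// => i _; rewrite indicE mem_set//.
    by move: xB; rewrite inE => /(_ i Logic.I).
  have [i iB] : exists i, ~ B i (tnth x i).
    apply: contrapT => /forallNP h; move: xB => /negP; apply.
    by rewrite inE => i _; apply: contrapT; exact: h.
  by rewrite (bigD1 i)//= indicE memNset// mul0r.
rewrite (ge0_integral_prob_pow_prod _ (g := fun i => \1_(B i)))//.
by apply: eq_bigr => i _; rewrite integral_indic// setIT.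
Qed.

Lemma sample_lawE : is_iid_sample X s ->
  forall A, measurable A -> distribution P sample_tuple A = iid_law s n A.
Proof.
move=> [Xs Xind].
apply: (measure_unique rectangles (fun=> setT)).
- exact: measurable_rectangles.
- move=> _ _ [A mA ->] [B mB ->]; exists (fun i => A i `&` B i).
    by move=> i; exact: measurableI.
  apply/seteqP; split=> x /=.
    by move=> [xA xB] i _; split; [exact: xA|exact: xB].
  by move=> xAB; split=> i _; have [] := xAB i Logic.I.
- move=> _; exists (fun=> setT) => //; apply/seteqP; split=> //.
- by apply/seteqP; split=> // x _; exists 0%N.
- move=> _ [B mB ->]; apply: etrans (esym (iid_law_rectangle mB)).
  rewrite /= /distribution /pushforward.
  have -> : sample_tuple @^-1` (\bigcap_i [set x | B i (tnth x i)]) =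
      \bigcap_i (X i @^-1` B i).
    by apply/seteqP; split=> w wB i Ii; have := wB i Ii;
      rewrite /= tnth_mktuple.
  rewrite Xind//; apply: eq_bigr => i _; by rewrite -(Xs i).
- move=> _; apply: (@le_lt_trans _ _ 1%E); last exact: ltry.
  exact: (probability_le1 (distribution P sample_tuple)).
Qed.

Lemma ge0_integral_sample (F : n.-tuple T -> R) : is_iid_sample X s ->
  measurable_fun setT F -> (forall x, 0 <= F x) ->
  ('E_P[fun w => F [tuple X i w | i < n]] = \int[iid_law s n]_x (F x)%:E)%E.
Proof.
move=> Xs mF F0; rewrite unlock.
transitivity (\int[distribution P sample_tuple]_x (F x)%:E)%E.
  by rewrite ge0_integral_distribution//; exact/measurable_EFinP.
by apply: eq_measure_integral => A mA _; exact: sample_lawE.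
Qed.

End sample_law.

(** * Exponential moments of centered sums *)

Section exponential_bounds.
Context (d : measure_display) (T : measurableType d) (R : realType).
Variables (P : probability T R) (n : nat).
Implicit Types g h : T -> R.

Definition centered_sum g (x : n.-tuple T) : R :=
  \sum_(i < n) g (tnth x i) - n%:R * \int[P]_y g y.

Lemma bounded_mfun_sum_tnth g : bounded_mfun g ->
  bounded_mfun (fun x : n.-tuple T => \sum_(i < n) g (tnth x i)).
Proof.
move=> [mg [B gB]]; apply: bounded_mfun_sum => i; split.
  by apply: measurableT_comp => //; exact: measurable_tnth.
by exists B.
Qed.

Lemma bounded_mfun_centered_sum g :
  bounded_mfun g -> bounded_mfun (centered_sum g).
Proof.
move=> bg; apply: bounded_mfunB; first exact: bounded_mfun_sum_tnth.
exact: bounded_mfun_cst.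
Qed.

Lemma centered_sumD g h x : bounded_mfun g -> bounded_mfun h ->
  centered_sum (fun y => g y + h y) x = centered_sum g x + centered_sum h x.
Proof.
move=> bg bh; rewrite /centered_sum Rintegral_boundedD// big_split/=; ring.
Qed.

(** Used to replace functions of [f], which may form an infinite family, by functions of the
    brackets, which take finitely many values per level. The price is the mean of the dominating
    function. *)
Lemma centered_sum_dominated g h x : bounded_mfun g -> bounded_mfun h ->
  (forall y, 0 <= g y <= h y) ->
  `|centered_sum g x| <= `|centered_sum h x| + n%:R * \int[P]_y h y.
Proof.
move=> bg bh gh; rewrite /centered_sum.
have g0 : 0 <= \int[P]_y g y.
  by apply: Rintegral_ge0 => y _; have /andP[] := gh y.
have gh1 : \int[P]_y g y <= \int[P]_y h y.
  by apply: le_Rintegral_bounded => // y; have /andP[] := gh y.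
have s0 : 0 <= \sum_(i < n) g (tnth x i).
  by apply: sumr_ge0 => i _; have /andP[] := gh (tnth x i).
have s1 : \sum_(i < n) g (tnth x i) <= \sum_(i < n) h (tnth x i).
  by apply: ler_sum => i _; have /andP[] := gh (tnth x i).
have n0 : 0 <= n%:R :> R by [].
have p0 := mulr_ge0 n0 g0.
have p1 := ler_wpM2l n0 gh1.
rewrite ler_norml; apply/andP; split.
  have := normr_ge0 (\sum_(i < n) h (tnth x i) - n%:R * \int[P]_y h y); lra.
have := ler_norm (\sum_(i < n) h (tnth x i) - n%:R * \int[P]_y h y); lra.
Qed.

(** [expR (- x) >= 1 - x] gives [expR x * (1 - x) <= 1], while [(1 + x + 2 * x ^ 2) * (1 - x) = 1 +
    x ^ 2 * (1 - 2 * x)] is at least 1 for [x <= 1 / 2]. *)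
Lemma expR_le_quadratic (x : R) : `|x| <= 2^-1 -> expR x <= 1 + x + 2 * x ^+ 2.
Proof.
rewrite ler_norml => /andP[x1 x2].
have e1 := expR_ge1Dx (- x); have e2 := expRxMexpNx_1 x.
have e0 := expR_gt0 x.
have h : expR x * (1 - x) <= expR x * expR (- x) by rewrite ler_pM2l.
rewrite e2 in h.
have h2 : 1 <= (1 + x + 2 * x ^+ 2) * (1 - x).
  rewrite (_ : _ * _ = 1 + x ^+ 2 * (1 - 2 * x)); last ring.
  rewrite lerDl mulr_ge0 ?sqr_ge0//; lra.
have := le_trans h h2; rewrite ler_pM2r//; lra.
Qed.

(** Bernstein's argument: the quadratic bound controls each factor and independence multiplies them.
    The uncentered second moment serves as variance proxy, and the linear term [lam * e] cancels
    against the centering. *)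
Lemma exp_centered_sum_le (lam v : R) g : bounded_mfun g ->
  (forall y, `|lam * g y| <= 2^-1) -> \int[P]_y (g y ^+ 2) <= v ->
  \int[prob_pow P n]_x expR (lam * centered_sum g x) <=
    expR (2 * n%:R * lam ^+ 2 * v).
Proof.
move=> bg lg gv.
have blg : bounded_mfun (fun y => lam * g y).
  by apply: bounded_mfunM => //; exact: bounded_mfun_cst.
have beg := bounded_mfun_expR blg.
set e := \int[P]_y g y.
have E1 : \int[P]_y expR (lam * g y) <= expR (lam * e + 2 * lam ^+ 2 * v).
  apply: (@le_trans _ _ (\int[P]_y (1 + lam * g y + (2 * lam ^+ 2) * g y ^+ 2))).
    have bq : bounded_mfun (fun y => 1 + lam * g y + 2 * lam ^+ 2 * g y ^+ 2).
      apply: bounded_mfunD; first by apply: bounded_mfunD => //; exact: bounded_mfun_cst.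
      by apply: bounded_mfunM; [exact: bounded_mfun_cst|exact: bounded_mfunX].
    apply: le_Rintegral_bounded => // y.
    by rewrite (le_trans (expR_le_quadratic (lg y)))// exprMn mulrA.
  rewrite Rintegral_boundedD; last 2 first.
  - by apply: bounded_mfunD => //; exact: bounded_mfun_cst.
  - by apply: bounded_mfunM; [exact: bounded_mfun_cst|exact: bounded_mfunX].
  rewrite Rintegral_boundedD//; last exact: bounded_mfun_cst.
  rewrite Rintegral_prob_cst !Rintegral_boundedZ//; last exact: bounded_mfunX.
  rewrite -/e; apply: le_trans (expR_ge1Dx _).
  by rewrite -addrA lerD2l lerD2l ler_wpM2l// mulr_ge0// sqr_ge0.
have E2 : \int[prob_pow P n]_x expR (lam * centered_sum g x) =
    (\int[P]_y expR (lam * g y)) ^+ n * expR (- (n%:R * (lam * e))).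
  have -> : (fun x => expR (lam * centered_sum g x)) =
      (fun x => expR (- (n%:R * (lam * e))) *
                \prod_(i < n) expR (lam * g (tnth x i))).
    apply/funext => x; rewrite -expR_sum -expRD; congr expR.
    rewrite /centered_sum mulrBr -mulr_sumr -/e; ring.
  have bp : bounded_mfun (fun x : n.-tuple T => \prod_(i < n) expR (lam * g (tnth x i))).
    under eq_fun do rewrite -expR_sum.
    by apply: bounded_mfun_expR; exact: (bounded_mfun_sum_tnth blg).
  rewrite Rintegral_boundedZ// mulrC; congr (_ * _).
  apply: EFin_inj; rewrite Rintegral_boundedE//.
  rewrite (ge0_integral_prob_pow_prod P (g := fun=> fun y => expR (lam * g y))).
  - under eq_bigr do rewrite -Rintegral_boundedE//.
    by rewrite prodEFin prodr_const card_ord.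
  - by move=> _; have [] := beg.
  - by move=> *; exact: expR_ge0.
rewrite E2.
have i0 : 0 <= \int[P]_y expR (lam * g y).
  by apply: Rintegral_ge0 => *; exact: expR_ge0.
apply: (@le_trans _ _ (expR (lam * e + 2 * lam ^+ 2 * v) ^+ n *
    expR (- (n%:R * (lam * e))))).
  by rewrite ler_wpM2r ?expR_ge0// lerXn2r// nnegrE// expR_ge0.
by rewrite -expRM_natl -expRD ler_expR le_eqVlt; apply/orP; left; apply/eqP; ring.
Qed.

Variable I : Type.
Implicit Types Y : I -> n.-tuple T -> R.

(* The scale c and the level E add up under sums (exp_bounded_add), which is
   what makes this form of exponential moment bound suited to chaining. *)
Definition exp_bounded Y (c E : R) : Prop :=
  exists W : n.-tuple T -> R, [/\ bounded_mfun W,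
    \int[prob_pow P n]_x W x <= 1 &
    forall i x, expR ((Y i x - E) / c) <= W x].

Lemma exp_bounded_le Y Y' (c E E' : R) : 0 < c ->
  (forall i x, Y' i x - E' <= Y i x - E) ->
  exp_bounded Y c E -> exp_bounded Y' c E'.
Proof.
move=> c0 YY' [W [bW W1 YW]]; exists W; split=> // i x.
by rewrite (le_trans _ (YW i x))// ler_expR ler_pM2r ?invr_gt0.
Qed.

Lemma exp_bounded_add Y1 Y2 (c1 c2 E1 E2 : R) : 0 < c1 -> 0 < c2 ->
  exp_bounded Y1 c1 E1 -> exp_bounded Y2 c2 E2 ->
  exp_bounded (fun i x => Y1 i x + Y2 i x) (c1 + c2) (E1 + E2).
Proof.
move=> c10 c20 [W1 [bW1 W11 YW1]] [W2 [bW2 W21 YW2]].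
have c0 : 0 < c1 + c2 by exact: addr_gt0.
set p1 := c1 / (c1 + c2); set p2 := c2 / (c1 + c2).
have p12 : p1 + p2 = 1 by rewrite /p1 /p2; field; lra.
have p10 : 0 <= p1 by rewrite divr_ge0// ltW.
have p20 : 0 <= p2 by rewrite divr_ge0// ltW.
have b1 : bounded_mfun (fun x => p1 * W1 x).
  by apply: bounded_mfunM => //; exact: bounded_mfun_cst.
have b2 : bounded_mfun (fun x => p2 * W2 x).
  by apply: bounded_mfunM => //; exact: bounded_mfun_cst.
exists (fun x => p1 * W1 x + p2 * W2 x); split; first exact: bounded_mfunD.
  rewrite Rintegral_boundedD// !Rintegral_boundedZ// -[leRHS]p12.
  by rewrite lerD// ler_piMr.
move=> i x; have := YW1 i x; have := YW2 i x.
set a := (Y1 i x - E1) / c1; set b := (Y2 i x - E2) / c2 => hb ha.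
have -> : (Y1 i x + Y2 i x - (E1 + E2)) / (c1 + c2) = p1 * a + p2 * b.
  by rewrite /p1 /p2 /a /b; field; rewrite !gt_eqF.
apply: (@le_trans _ _ (p1 * expR a + p2 * expR b)); last first.
  by rewrite lerD// ler_wpM2l.
set y := p1 * a + p2 * b.
(* Convexity of the exponential, in the form of its tangent at the weighted mean [y]. *)
have t z : expR y * (1 + z - y) <= expR z.
  have -> : expR z = expR y * expR (z - y) by rewrite -expRD addrC subrK.
  rewrite ler_pM2l ?expR_gt0//.
  by rewrite -addrA expR_ge1Dx.
apply: (@le_trans _ _ (p1 * (expR y * (1 + a - y)) + p2 * (expR y * (1 + b - y)))).
  have -> : p1 * (expR y * (1 + a - y)) + p2 * (expR y * (1 + b - y)) =
    expR y * ((p1 + p2) * (1 - y) + y) by rewrite /y; ring.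
  by rewrite p12 mul1r subrK mulr1.
by rewrite lerD// ler_wpM2l.
Qed.

Lemma exp_bounded_scale Y (c c' E : R) : 0 < c -> c <= c' ->
  exp_bounded Y c E -> exp_bounded Y c' E.
Proof.
move=> c0; rewrite le_eqVlt => /predU1P[<-//|cc'] YcE.
have Z0 : exp_bounded (fun=> fun=> 0) (c' - c) 0.
  exists (fun=> 1); split; first exact: bounded_mfun_cst.
    by rewrite Rintegral_prob_cst.
  by move=> i x; rewrite subr0 mul0r expR0.
have c'0 : 0 < c' - c by rewrite subr_gt0.
have := exp_bounded_add c0 c'0 YcE Z0.
rewrite addr0 addrC subrK; apply: exp_bounded_le; first exact: lt_trans cc'.
by move=> i x; rewrite addr0.
Qed.

(** A union bound: at most [m] distinct functions occur, and the exponentials for both signs of each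
    are summed into the majorant. The three terms on the left of the last hypothesis pay for the
    number of functions, the two signs and the second moment. *)
Lemma exp_bounded_finite (i0 : I) (g : I -> T -> R) (code : I -> nat) (m : nat)
    (lam E v : R) : 0 < lam -> (0 < m)%N ->
  (forall i, (code i < m)%N) -> (forall i j, code i = code j -> g i = g j) ->
  (forall i, bounded_mfun (g i)) ->
  (forall i x, `|g i x| <= (2 * lam)^-1) ->
  (forall i, \int[P]_x (g i x ^+ 2) <= v) ->
  ln m%:R + ln 2 + 2 * n%:R * lam ^+ 2 * v <= lam * E ->
  exp_bounded (fun i x => `|centered_sum (g i) x|) lam^-1 E.
Proof.
move=> lam0 m0 cm cg bg gb gv LE.
(* One index per code value; a value that is not attained receives [i0], which adds a harmless
   nonnegative term to [W]. *)
pose rep q := if pselect (exists i, code i = q) is left h then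
  projT1 (cid h) else i0.
have repE i : g (rep (code i)) = g i.
  rewrite /rep; case: pselect => [h|]; last by case; exists i.
  by case: cid => j /= /cg.
have lgb i y : `|lam * g i y| <= 2^-1.
  rewrite normrM gtr0_norm//; have := gb i y; rewrite -(ler_pM2l lam0) => h.
  apply: le_trans h _; rewrite invfM mulrCA mulfV ?mulr1//; exact: lt0r_neq0.
pose W x := expR (- (lam * E)) * \sum_(q < m)
  (expR (lam * centered_sum (g (rep q)) x) + expR (- lam * centered_sum (g (rep q)) x)).
have be mu i : bounded_mfun (fun x => expR (mu * centered_sum (g i) x)).
  apply: bounded_mfun_expR; apply: bounded_mfunM; first exact: bounded_mfun_cst.
  exact: bounded_mfun_centered_sum.
have bs (q : 'I_m) : bounded_mfun (fun x => expR (lam * centered_sum (g (rep q)) x) +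
    expR (- lam * centered_sum (g (rep q)) x)) by exact: bounded_mfunD.
have bsum (r : seq 'I_m) : bounded_mfun (fun x => \sum_(q <- r)
  (expR (lam * centered_sum (g (rep q)) x) + expR (- lam * centered_sum (g (rep q)) x))).
  exact: bounded_mfun_sum.
exists W; split.
- by apply: bounded_mfunM => //; exact: bounded_mfun_cst.
- rewrite Rintegral_boundedZ//.
  have S (r : seq 'I_m) : \int[prob_pow P n]_x (\sum_(q <- r)
      (expR (lam * centered_sum (g (rep q)) x) + expR (- lam * centered_sum (g (rep q)) x)))
      <= (size r)%:R * (2 * expR (2 * n%:R * lam ^+ 2 * v)).
    elim: r => [|q r IH].
      under eq_Rintegral do rewrite big_nil.
      by rewrite Rintegral_prob_cst mul0r.
    under eq_Rintegral do rewrite big_cons.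
    rewrite Rintegral_boundedD// /= mulrS mulrDl mul1r lerD//.
    rewrite Rintegral_boundedD// mulr_natl mulr2n lerD//.
      exact: exp_centered_sum_le.
    rewrite -[in leRHS](sqrrN lam); apply: exp_centered_sum_le => // y.
    by rewrite mulNr normrN.
  have := S (index_enum 'I_m); rewrite (_ : size _ = m); last first.
    by rewrite /index_enum -enumT size_enum_ord.
  move=> {}S.
  apply: (@le_trans _ _ (expR (- (lam * E)) *
      (m%:R * (2 * expR (2 * n%:R * lam ^+ 2 * v))))).
    by rewrite ler_wpM2l ?expR_ge0.
  have -> : m%:R * (2 * expR (2 * n%:R * lam ^+ 2 * v)) =
    expR (ln m%:R) * (expR (ln 2) * expR (2 * n%:R * lam ^+ 2 * v)).
    by rewrite !lnK ?posrE ?ltr0n.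
  rewrite -!expRD -[leRHS]expR0 ler_expR; lra.
- move=> i x.
  have -> : (`|centered_sum (g i) x| - E) / lam^-1 =
    - (lam * E) + lam * `|centered_sum (g i) x| by rewrite invrK; ring.
  rewrite /W expRD ler_pM2l ?expR_gt0//.
  rewrite (bigD1 (Ordinal (cm i)))//= repE.
  have e1 := expR_ge0 (lam * centered_sum (g i) x).
  have e2 := expR_ge0 (- lam * centered_sum (g i) x).
  have e3 : 0 <= \sum_(q < m | q != Ordinal (cm i))
    (expR (lam * centered_sum (g (rep q)) x) + expR (- lam * centered_sum (g (rep q)) x)).
    by apply: sumr_ge0 => q _; rewrite addr_ge0 ?expR_ge0.
  have [z0|z0] := leP 0 (centered_sum (g i) x).
    by rewrite ger0_norm//; lra.
  by rewrite ltr0_norm// mulrN -mulNr; lra.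
Qed.

End exponential_bounds.

(** * Bracketing chaining *)

Section bracketing_chaining.
Context (d : measure_display) (T : measurableType d) (R : realType).
Variables (P : probability T R) (n : nat) (I : Type) (i0 : I).
Variables (f : I -> T -> R) (l u : nat -> I -> T -> R).
Variables (c : nat -> I -> nat) (N : nat -> nat) (sg gam : R).
Hypotheses (n_gt0 : (0 < n)%N) (sg_gt0 : 0 < sg)
  (gam_gt0 : 0 < gam) (gam_le : gam <= 4^-1).
Hypotheses (mf : forall i, measurable_fun setT (f i))
  (ml : forall k i, measurable_fun setT (l k i))
  (mu : forall k i, measurable_fun setT (u k i))
  (f_le1 : forall i x, `|f i x| <= 1)
  (l_le1 : forall k i x, `|l k i x| <= 1)
  (u_le1 : forall k i x, `|u k i x| <= 1)
  (lfu : forall k i x, l k i x <= f i x <= u k i x)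
  (c_lt : forall k i, (c k i < N k)%N)
  (c_eq : forall k i j, c k i = c k j -> l k i = l k j /\ u k i = u k j)
  (N_ge2 : forall k, (2 <= N k)%N).

Let rn : R := Num.sqrt n%:R.
Let del k : R := sg / 2 ^+ k.
Let s k : R := Num.sqrt (ln (N k)%:R).

Hypothesis f_var : forall i, \int[P]_x (f i x ^+ 2) <= 2 * sg ^+ 2.
Hypothesis d_var : forall k i,
  \int[P]_x ((u k i x - l k i x) ^+ 2) <= 8 * del k ^+ 2.
Hypothesis entropy : forall J,
  \sum_(k < J) del k * s k <= gam / 4 * (rn * sg ^+ 2).

Let rn_gt0 : 0 < rn. Proof. by rewrite sqrtr_gt0 ltr0n. Qed.

Let rn2 : rn ^+ 2 = n%:R. Proof. by rewrite sqr_sqrtr. Qed.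

Let del_gt0 k : 0 < del k.
Proof. by rewrite divr_gt0// exprn_gt0. Qed.

Let delS k : del k = 2 * del k.+1.
Proof. by rewrite /del exprS invfM; field; rewrite expf_neq0. Qed.

Let del2S k : del k ^+ 2 = 4 * del k.+1 ^+ 2.
Proof. by rewrite (delS k); ring. Qed.

Let s_ge0 k : 0 <= s k. Proof. exact: sqrtr_ge0. Qed.

(** The sum dominates the square root of the log-number of bracket paths up to level [k]. The
    constant term keeps the thresholds [a k] below [(4 / gam) / 2 ^ k], so that the total scale
    depends on [gam] alone. *)
Let Theta k : R := \sum_(j < k.+1) s j + gam / 4 * (rn * sg).

Let Theta_ge k : gam / 4 * (rn * sg) <= Theta k.
Proof. by rewrite lerDr sumr_ge0. Qed.

Let Theta_gt0 k : 0 < Theta k.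
Proof. by apply: lt_le_trans (Theta_ge k); rewrite !mulr_gt0// invr_gt0. Qed.

Let Theta_le k : Theta k <= Theta k.+1.
Proof. by rewrite lerD2r [leRHS]big_ord_recr /= lerDl. Qed.

Let sum_del J : \sum_(k < J) del k <= 2 * sg.
Proof.
have -> : \sum_(k < J) del k = 2 * sg - 2 * del J.
  elim: J => [|J IH]; first by rewrite big_ord0 /del expr0 divr1 subrr.
  by rewrite big_ord_recr /= IH (delS J); ring.
have := del_gt0 J; lra.
Qed.

Let sum_del_Theta J : \sum_(k < J) del k * Theta k <= gam * (rn * sg ^+ 2).
Proof.
(* Summation by parts: as [del] halves at each step, replacing [s k] by the partial sum up to [k] at
   most doubles the entropy sum. The boundary term is nonnegative and dropped below. *)
have E : \sum_(k < J) del k * (\sum_(j < k.+1) s j) +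
    2 * del J * \sum_(j < J) s j = 2 * \sum_(k < J) del k * s k.
  elim: J => [|J IH]; first by rewrite !big_ord0 !mulr0 addr0.
  rewrite [X in X + _]big_ord_recr [X in _ = _ * X]big_ord_recr /= mulrDr -IH.
  rewrite !(big_ord_recr J) /= (delS J); ring.
rewrite /Theta; under eq_bigr do rewrite mulrDr.
rewrite big_split /= -mulr_suml.
have e1 := entropy J; have e2 := sum_del J.
have e3 : 0 <= del J * \sum_(j < J) s j.
  by apply: mulr_ge0; [exact/ltW|exact: sumr_ge0].
have e4 : 0 <= gam / 4 * (rn * sg) by rewrite ltW// !mulr_gt0// invr_gt0.
have e5 := ler_wpM2r e4 e2.
have -> : gam * (rn * sg ^+ 2) =
  2 * (gam / 4 * (rn * sg ^+ 2)) + 2 * sg * (gam / 4 * (rn * sg)) by field.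
lra.
Qed.

Let del_Theta k : del k * Theta k <= gam * (rn * sg ^+ 2).
Proof.
apply: le_trans (sum_del_Theta k.+1); rewrite big_ord_recr /= lerDr.
by apply: sumr_ge0 => j _; rewrite mulr_ge0// ltW ?del_gt0 ?Theta_gt0.
Qed.

Let m k := (\prod_(j < k.+1) N j)%N.

(* Mixed-radix encoding of the bracket indices c 0 i, ..., c k i: the truncated
   increments below depend on all levels up to k, not only on the last one. *)
Fixpoint path_code k i : nat :=
  if k is k'.+1 then (path_code k' i * N k + c k i)%N else c 0%N i.

Let path_code_lt k i : (path_code k i < m k)%N.
Proof.
elim: k => [|k IH] /=; first by rewrite /m big_ord_recr big_ord0 /= mul1n.
rewrite /m big_ord_recr /=.
apply: (@leq_trans ((path_code k i).+1 * N k.+1)); last by rewrite leq_mul2r IH orbT.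
by rewrite mulSn addnC ltn_add2r.
Qed.

Let path_code_eq k i j : path_code k i = path_code k j ->
  forall q, (q <= k)%N -> l q i = l q j /\ u q i = u q j.
Proof.
elim: k => [|k IH] /=.
  by move=> h q; rewrite leqn0 => /eqP ->; exact: c_eq.
have Nk : (0 < N k.+1)%N by exact: leq_trans (N_ge2 _).
move=> h q; rewrite leq_eqVlt => /predU1P[->|].
  apply: c_eq; have := congr1 (modn^~ (N k.+1)) h.
  by rewrite /= !modnMDl !modn_small.
rewrite ltnS; apply: IH; have := congr1 (divn^~ (N k.+1)) h.
by rewrite /= !divnMDl// !divn_small// !addn0.
Qed.

Let m_ge2 k : (2 <= m k)%N.
Proof.
rewrite /m big_ord_recr /=; apply: (leq_trans (N_ge2 k)).
rewrite leq_pmull// prodn_gt0// => j; exact: leq_trans (N_ge2 _).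
Qed.

Let ln_m k : ln (m k)%:R <= Theta k ^+ 2.
Proof.
have N0 q : 0 < (N q)%:R :> R by rewrite ltr0n (leq_trans _ (N_ge2 q)).
have -> : ln (m k)%:R = \sum_(j < k.+1) s j ^+ 2 :> R.
  elim: k => [|k IH].
    rewrite /m !big_ord_recr !big_ord0 /= mul1n add0r sqr_sqrtr// ln_ge0//.
    by rewrite ler1n (leq_trans _ (N_ge2 0)).
  rewrite /m big_ord_recr /= natrM lnM ?posrE//; last first.
    by rewrite ltr0n (leq_trans _ (m_ge2 k)).
  rewrite [RHS]big_ord_recr /= -IH sqr_sqrtr// ln_ge0//.
  by rewrite ler1n (leq_trans _ (N_ge2 _)).
apply: (@le_trans _ _ ((\sum_(j < k.+1) s j) ^+ 2)).
  elim: k => [|k IH]; first by rewrite !big_ord_recr !big_ord0 /= !add0r.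
  rewrite big_ord_recr [in leRHS]big_ord_recr /= sqrrD.
  have : 0 <= (\sum_(j < k.+1) s j) * s k.+1 by rewrite mulr_ge0// sumr_ge0.
  by rewrite mulr2n; lra.
rewrite lerXn2r ?nnegrE//; [exact: sumr_ge0|exact/ltW|].
by rewrite lerDl ltW// !mulr_gt0// invr_gt0.
Qed.

(** The threshold balances the variance term [n * del k ^ 2 / a k ^ 2] against the log-cardinality
    bound [Theta k.+1 ^ 2]. *)
Let a k : R := rn * del k / Theta k.+1.

Let a_gt0 k : 0 < a k.
Proof. by rewrite divr_gt0 ?Theta_gt0// mulr_gt0. Qed.

Let a_le k : a k.+1 <= a k.
Proof.
rewrite /a ler_pM//; [exact/ltW/mulr_gt0|by rewrite invr_ge0 ltW| |].
  by rewrite ler_pM2l// (delS k); have := del_gt0 k.+1; lra.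
by rewrite lef_pV2 ?posrE ?Theta_gt0.
Qed.

(** Bracket widths never exceed 2, so nothing is truncated at level 0. The value 2 comes out of
    [gam <= 1 / 4]. *)
Let a0_ge2 : 2 <= a 0.
Proof.
have h := del_Theta 1; have t0 := Theta_gt0 1.
rewrite /a ler_pdivlMr// (delS 0) -(ler_pM2r sg_gt0).
have d1 : del 1 = sg / 2 by rewrite /del expr1.
have r0 : 0 < rn * sg ^+ 2 by rewrite mulr_gt0// exprn_gt0.
have h2 := ler_wpM2r (ltW r0) gam_le.
have -> : rn * (2 * del 1) * sg = rn * sg ^+ 2 by rewrite d1; field.
have -> : 2 * Theta 1 * sg = 4 * (del 1 * Theta 1) by rewrite d1; field.
lra.
Qed.

Let E_ k : R := 20 * (rn * del k * Theta k.+1).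

(** With [lam = 1 / (4 * a k)], cardinality, sign and variance cost at most [1 + 1 + 5 / 2] times
    [Theta k.+1 ^ 2], against [lam * E_ k = 5 * Theta k.+1 ^ 2]. The factor 20 is dictated by the
    first link, [l 0]. *)
Let exp_bounded_level k (g : I -> T -> R) :
  (forall i, bounded_mfun (g i)) ->
  (forall i j, path_code k.+1 i = path_code k.+1 j -> g i = g j) ->
  (forall i x, `|g i x| <= 2 * a k) ->
  (forall i, \int[P]_x (g i x ^+ 2) <= 20 * del k ^+ 2) ->
  exp_bounded P (fun i (x : n.-tuple T) => `|centered_sum P (g i) x|) (4 * a k) (E_ k).
Proof.
move=> bg cg ga gv; rewrite -[4 * a k]invrK.
have a0 := a_gt0 k; have t0 := Theta_gt0 k.+1; have d0 := del_gt0 k.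
apply: (exp_bounded_finite (n := n) i0 (code := path_code k.+1) (m := m k.+1)
  (v := 20 * del k ^+ 2)) => //.
- by rewrite invr_gt0 mulr_gt0.
- exact: leq_trans (m_ge2 _).
- move=> i x; apply: le_trans (ga i x) _.
  by rewrite invfM invrK le_eqVlt; apply/orP; left; apply/eqP; field.
- have L := ln_m k.+1.
  have L2 : ln 2 <= Theta k.+1 ^+ 2.
    apply: le_trans L; rewrite ler_ln ?posrE ?ler_nat ?ltr0n//.
    exact: leq_trans (m_ge2 _).
  have -> : 2 * n%:R * (4 * a k)^-1 ^+ 2 * (20 * del k ^+ 2) = 5 / 2 * Theta k.+1 ^+ 2.
    by rewrite -rn2 /a; field; rewrite !gt_eqF.
  have -> : (4 * a k)^-1 * E_ k = 5 * Theta k.+1 ^+ 2.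
    by rewrite /E_ /a; field; rewrite !gt_eqF.
  have := sqr_ge0 (Theta k.+1); lra.
Qed.

Let D k i x : R := u k i x - l k i x.

Let bl k i : bounded_mfun (l k i). Proof. by split; last by exists 1. Qed.
Let bu k i : bounded_mfun (u k i). Proof. by split; last by exists 1. Qed.
Let bf i : bounded_mfun (f i). Proof. by split; last by exists 1. Qed.
Let bD k i : bounded_mfun (D k i). Proof. exact: bounded_mfunB. Qed.

(* Truncation: kept k is the event that every bracket width up to level k is
   below its threshold a j. The remainder (f - l k) 1_{kept k} is split into
   A k (refine the bracket, all widths still small), C k <= B k (the width at
   level k + 1 exceeds a (k + 1), so Markov bounds its mean) and the next
   remainder. *)
Fixpoint kept k i (x : T) : bool :=
  if k is k'.+1 then kept k' i x && (D k i x <= a k) else D 0%N i x <= a 0%N.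

Let J k i x : R := (kept k i x)%:R.

Let mkept k i : measurable_fun setT (kept k i).
Proof.
have h q : measurable_fun setT (fun x => D q i x <= a q).
  apply: measurable_fun_ler; [by have [] := bD q i|exact: measurable_cst].
elim: k => [|k IH] /=; first exact: h.
by apply: measurable_and => //; exact: h.
Qed.

Let bJ k i : bounded_mfun (J k i).
Proof.
split; last by exists 1 => x; rewrite /J; case: kept; rewrite ?normr1 ?normr0.
rewrite (_ : J k i = \1_[set x | kept k i x]); last first.
  apply/funext => x; rewrite indicE /J; case: (boolP (kept k i x)) => h.
    by rewrite mem_set.
  by rewrite memNset//; exact/negP.
apply: measurable_indic.
rewrite -[X in measurable X]setTI.
have mt : measurable ([set true] : set bool) by [].
exact: (mkept k i measurableT mt).
Qed.

Let D_ge0 k i x : 0 <= D k i x.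
Proof. by rewrite subr_ge0; have /andP[/le_trans] := lfu k i x; apply. Qed.

Let kept_eq k i j : path_code k i = path_code k j -> kept k i = kept k j.
Proof.
move=> /path_code_eq; elim: k => [|k IH] h; apply/funext => x /=.
  by rewrite /D; have [-> ->] := h 0%N (leqnn _).
rewrite IH; last by move=> q qk; apply: h; exact: leqW.
by rewrite /D; have [-> ->] := h k.+1 (leqnn _).
Qed.

Let path_codeS k i j : path_code k.+1 i = path_code k.+1 j ->
  path_code k i = path_code k j.
Proof.
move=> /= h; have Nk : (0 < N k.+1)%N by exact: leq_trans (N_ge2 _).
have := congr1 (divn^~ (N k.+1)) h.
by rewrite /= !divnMDl// !divn_small// !addn0.
Qed.

Let A k i x : R := (l k.+1 i x - l k i x) * J k.+1 i x.
Let B k i x : R := D k i x * (J k i x - J k.+1 i x).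
Let C k i x : R := (f i x - l k i x) * (J k i x - J k.+1 i x).
Let Rem k i x : R := (f i x - l k i x) * J k i x.
(** Dominates [Rem k] by a function of the brackets alone; it closes the telescoping at the last
    level. *)
Let F k i x : R := D k i x * J k i x.

Let bA k i : bounded_mfun (A k i).
Proof. exact: (bounded_mfunM (bounded_mfunB (bl k.+1 i) (bl k i)) (bJ k.+1 i)). Qed.
Let bB k i : bounded_mfun (B k i).
Proof. exact: (bounded_mfunM (bD k i) (bounded_mfunB (bJ k i) (bJ k.+1 i))). Qed.
Let bC k i : bounded_mfun (C k i).
Proof.
exact: (bounded_mfunM (bounded_mfunB (bf i) (bl k i))
  (bounded_mfunB (bJ k i) (bJ k.+1 i))).
Qed.
Let bRem k i : bounded_mfun (Rem k i).
Proof. exact: (bounded_mfunM (bounded_mfunB (bf i) (bl k i)) (bJ k i)). Qed.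
Let bF k i : bounded_mfun (F k i).
Proof. exact: (bounded_mfunM (bD k i) (bJ k i)). Qed.

Let D2 k i : \int[P]_x (D k i x ^+ 2) <= 8 * del k ^+ 2.
Proof. exact: d_var. Qed.

Let bD2 k i : bounded_mfun (fun x => D k i x ^+ 2).
Proof. exact: bounded_mfunX. Qed.

Let fl k i x : 0 <= f i x - l k i x <= D k i x.
Proof.
have /andP[h1 h2] := lfu k i x.
by rewrite subr_ge0 h1 /D lerD2r.
Qed.

Let kept_le k i x : kept k i x -> D k i x <= a k.
Proof. by case: k => [|k] //= /andP[]. Qed.

(** Successive brackets need not be nested, so [l k.+1 - l k] has no sign. Both lower ends lie below
    [f] within their widths, which keeps the difference between [- D k.+1] and [D k]. *)
Let exp_bounded_A k :
  exp_bounded P (fun i (x : n.-tuple T) => `|centered_sum P (A k i) x|) (4 * a k) (E_ k).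
Proof.
have key i x : `|A k i x| <= 2 * a k /\ A k i x ^+ 2 <= D k i x ^+ 2 + D k.+1 i x ^+ 2.
  have /andP[p1 p2] := fl k i x; have /andP[p3 p4] := fl k.+1 i x.
  have ak := a_gt0 k; have aS := a_le k.
  rewrite /A /J /=; case: andP => [[kk dk1]|_]; last first.
    by rewrite mulr0 normr0 expr0n /= addr_ge0 ?sqr_ge0// mulr_ge0// ltW.
  have dk := kept_le kk.
  split.
    rewrite mulr1 ler_norml; apply/andP; split; lra.
  rewrite mulr1.
  have [h|h] := leP (l k i x) (l k.+1 i x).
    have : (l k.+1 i x - l k i x) ^+ 2 <= D k i x ^+ 2.
      by rewrite lerXn2r ?nnegrE//; lra.
    have := sqr_ge0 (D k.+1 i x); lra.
  have : (l k.+1 i x - l k i x) ^+ 2 <= D k.+1 i x ^+ 2.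
    by rewrite -sqrrN lerXn2r ?nnegrE//; lra.
  have := sqr_ge0 (D k i x); lra.
apply: exp_bounded_level => // [i j ij|i x|i].
- apply/funext => x; rewrite /A /J (kept_eq ij).
  have [-> _] := path_code_eq ij (leqnn _).
  by have [-> _] := path_code_eq ij (leqnSn _).
- by have [] := key i x.
- apply: (@le_trans _ _ (\int[P]_x (D k i x ^+ 2 + D k.+1 i x ^+ 2))).
    apply: le_Rintegral_bounded; [exact: bounded_mfunX|exact: bounded_mfunD|].
    by move=> x; have [] := key i x.
  rewrite Rintegral_boundedD//; have := D2 k i; have := D2 k.+1 i.
  rewrite (del2S k); have := sqr_ge0 (del k.+1); lra.
Qed.

Let exp_bounded_B k :
  exp_bounded P (fun i (x : n.-tuple T) => `|centered_sum P (B k i) x|) (4 * a k) (E_ k).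
Proof.
have key i x : `|B k i x| <= 2 * a k /\ B k i x ^+ 2 <= D k i x ^+ 2.
  have ak := a_gt0 k; have d0 := D_ge0 k i x; have d2 := sqr_ge0 (D k i x).
  rewrite /B /J /=; case: (boolP (kept k i x)) => [kk|_] /=; last first.
    by rewrite subrr mulr0 normr0 expr0n /=; split=> //; lra.
  have dk := kept_le kk.
  case: (D k.+1 i x <= a k.+1) => /=.
    by rewrite subrr mulr0 normr0 expr0n /=; split=> //; lra.
  by rewrite subr0 mulr1 ger0_norm//; split=> //; lra.
apply: exp_bounded_level => // [i j ij|i x|i].
- apply/funext => x; rewrite /B /J (kept_eq ij) (kept_eq (path_codeS ij)) /D.
  by have [-> ->] := path_code_eq ij (leqnSn _).
- by have [] := key i x.
- apply: (@le_trans _ _ (\int[P]_x (D k i x ^+ 2))).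
    apply: le_Rintegral_bounded; [exact: bounded_mfunX|exact: bounded_mfunX|].
    by move=> x; have [] := key i x.
  apply: le_trans (D2 k i) _; have := sqr_ge0 (del k); lra.
Qed.

Let exp_bounded_F k :
  exp_bounded P (fun i (x : n.-tuple T) => `|centered_sum P (F k i) x|) (4 * a k) (E_ k).
Proof.
have key i x : `|F k i x| <= 2 * a k /\ F k i x ^+ 2 <= D k i x ^+ 2.
  have ak := a_gt0 k; have d0 := D_ge0 k i x; have d2 := sqr_ge0 (D k i x).
  rewrite /F /J /=; case: (boolP (kept k i x)) => [kk|_] /=; last first.
    by rewrite mulr0 normr0 expr0n /=; split=> //; lra.
  have dk := kept_le kk.
  by rewrite mulr1 ger0_norm//; split=> //; lra.
apply: exp_bounded_level => // [i j /path_codeS ij|i x|i].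
- apply/funext => x; rewrite /F /J (kept_eq ij) /D.
  by have [-> ->] := path_code_eq ij (leqnn _).
- by have [] := key i x.
- apply: (@le_trans _ _ (\int[P]_x (D k i x ^+ 2))).
    apply: le_Rintegral_bounded; [exact: bounded_mfunX|exact: bounded_mfunX|].
    by move=> x; have [] := key i x.
  apply: le_trans (D2 k i) _; have := sqr_ge0 (del k); lra.
Qed.

(** The first link is not an increment: writing [l 0 = f - (f - l 0)] bounds its second moment by
    [2 * 2 * sg ^ 2 + 2 * 8 * sg ^ 2]. *)
Let exp_bounded_l0 :
  exp_bounded P (fun i (x : n.-tuple T) => `|centered_sum P (l 0%N i) x|) (4 * a 0) (E_ 0).
Proof.
apply: exp_bounded_level => // [i j ij|i x|i].
- by have [-> _] := path_code_eq ij (leq0n _).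
- by apply: (le_trans (l_le1 _ _ _)); have := a0_ge2; lra.
- apply: (@le_trans _ _ (\int[P]_x (2 * f i x ^+ 2 + 2 * D 0 i x ^+ 2))).
    apply: le_Rintegral_bounded; first exact: bounded_mfunX.
      apply: bounded_mfunD; apply: bounded_mfunM; try exact: bounded_mfun_cst.
        exact: bounded_mfunX.
      exact: bounded_mfunX.
    move=> x; have /andP[p1 p2] := fl 0 i x.
    have h : (f i x - l 0 i x) ^+ 2 <= D 0 i x ^+ 2 by rewrite lerXn2r ?nnegrE.
    have := sqr_ge0 (f i x + (f i x - l 0 i x)).
    move: h; rewrite !expr2; lra.
  have bf2 : bounded_mfun (fun x => f i x ^+ 2) by exact: bounded_mfunX.
  rewrite Rintegral_boundedD; last 2 first.
  - by apply: bounded_mfunM => //; exact: bounded_mfun_cst.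
  - by apply: bounded_mfunM => //; exact: bounded_mfun_cst.
  rewrite !Rintegral_boundedZ//; have := D2 0 i; have := f_var i.
  rewrite /del expr0 divr1; lra.
Qed.

(** Where [B k] is nonzero, [D k.+1 > a k.+1], hence [D k <= D k * D k.+1 / a k.+1], and the product
    is at most half the sum of the squares. *)
Let n_int_B k i : n%:R * \int[P]_x B k i x <= 40 * (rn * del k.+2 * Theta k.+2).
Proof.
have a0 := a_gt0 k.+1; have t0 := Theta_gt0 k.+2; have d0 := del_gt0 k.+1.
have bq : bounded_mfun (fun x => D k i x ^+ 2 + D k.+1 i x ^+ 2) by exact: bounded_mfunD.
have h : \int[P]_x B k i x <=
    \int[P]_x ((2 * a k.+1)^-1 * (D k i x ^+ 2 + D k.+1 i x ^+ 2)).
  apply: le_Rintegral_bounded => //.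
    by apply: bounded_mfunM => //; exact: bounded_mfun_cst.
  move=> x; rewrite [leRHS]mulrC ler_pdivlMr; last by rewrite pmulr_rgt0.
  have d1 := D_ge0 k i x; have d2 := D_ge0 k.+1 i x.
  have sq := sqr_ge0 (D k i x - D k.+1 i x).
  have r0 : 0 <= D k i x ^+ 2 + D k.+1 i x ^+ 2 by rewrite addr_ge0 ?sqr_ge0.
  rewrite /B /J /=; case: (kept k i x) => /=; last by rewrite subrr mulr0 mul0r.
  case: (leP (D k.+1 i x) (a k.+1)) => [_|da] /=; first by rewrite subrr mulr0 mul0r.
  rewrite subr0 mulr1.
  have := ler_wpM2l d1 (ltW da); move: sq; rewrite !expr2; lra.
rewrite Rintegral_boundedZ// Rintegral_boundedD// in h.
have := D2 k i; have := D2 k.+1 i; rewrite (del2S k) => h1 h2.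
have h3 : \int[P]_x D k i x ^+ 2 + \int[P]_x D k.+1 i x ^+ 2 <= 40 * del k.+1 ^+ 2.
  have := sqr_ge0 (del k.+1); lra.
have n0 : 0 <= n%:R :> R by [].
apply: (@le_trans _ _ (n%:R * ((2 * a k.+1)^-1 * (40 * del k.+1 ^+ 2)))).
  rewrite ler_wpM2l//; apply: (le_trans h); rewrite ler_wpM2l//.
  by rewrite invr_ge0 mulr_ge0// ltW.
rewrite -rn2 /a (delS k.+1) le_eqVlt; apply/orP; left; apply/eqP.
by field; rewrite !gt_eqF.
Qed.

(** By [D <= D ^ 2 / (2 * del) + del / 2]. This mean is of order [n], not [sqrt n]; it becomes
    harmless only by stopping the chain at a level where [del k] is small compared with
    [gam * sg ^ 2]. *)
Let n_int_F k i : n%:R * \int[P]_x F k i x <= 9 / 2 * (n%:R * del k).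
Proof.
have d0 := del_gt0 k.
rewrite mulrCA ler_wpM2l//.
apply: (@le_trans _ _ (\int[P]_x ((2 * del k)^-1 * D k i x ^+ 2 + del k / 2))).
  apply: le_Rintegral_bounded => //.
    apply: bounded_mfunD; last exact: bounded_mfun_cst.
    by apply: bounded_mfunM => //; exact: bounded_mfun_cst.
  move=> x; apply: (@le_trans _ _ (D k i x)).
    by rewrite /F /J; case: kept; rewrite ?mulr1// mulr0.
  rewrite -subr_ge0.
  have -> : (2 * del k)^-1 * D k i x ^+ 2 + del k / 2 - D k i x =
    (2 * del k)^-1 * (D k i x - del k) ^+ 2 by field; rewrite gt_eqF.
  by rewrite mulr_ge0 ?sqr_ge0// invr_ge0 mulr_ge0// ltW.
rewrite Rintegral_boundedD; last 2 first.
- by apply: bounded_mfunM => //; exact: bounded_mfun_cst.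
- exact: bounded_mfun_cst.
rewrite Rintegral_prob_cst Rintegral_boundedZ//.
have h : (2 * del k)^-1 * (\int[P]_x D k i x ^+ 2) <= (2 * del k)^-1 * (8 * del k ^+ 2).
  by rewrite ler_wpM2l// invr_ge0 mulr_ge0// ltW.
have e : (2 * del k)^-1 * (8 * del k ^+ 2) = 4 * del k by field; rewrite gt_eqF.
lra.
Qed.

Let centered_sum_Rem k i (x : n.-tuple T) : `|centered_sum P (Rem k i) x| <=
  `|centered_sum P (A k i) x| +
    (`|centered_sum P (B k i) x| + n%:R * \int[P]_x B k i x) +
  `|centered_sum P (Rem k.+1 i) x| :> R.
Proof.
have -> : Rem k i = fun x => A k i x + C k i x + Rem k.+1 i x.
  by apply/funext => y; rewrite /Rem /A /C; ring.
rewrite centered_sumD//; last exact: bounded_mfunD.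
rewrite centered_sumD// (le_trans (ler_normD _ _))// lerD2r.
rewrite (le_trans (ler_normD _ _))// lerD2l.
apply: centered_sum_dominated => // y.
have J0 : 0 <= J k i y - J k.+1 i y.
  by rewrite /J /=; case: kept; case: (D k.+1 i y <= a k.+1); rewrite /= ?subr0 ?subrr.
have /andP[h1 h2] := fl k i y.
by rewrite /C /B mulr_ge0//= ler_wpM2r.
Qed.

(** Descent from level [K] to level 0: each step adds the links [A] and [B], each with scale
    [4 * a k] and level [E_ k], and the mean of [B k]. *)
Let exp_bounded_Rem K c0 e0 : 0 < c0 ->
  exp_bounded P (fun i (x : n.-tuple T) => `|centered_sum P (Rem K i) x|) c0 e0 ->
  exp_bounded P (fun i (x : n.-tuple T) => `|centered_sum P (Rem 0 i) x|)
    (c0 + \sum_(k < K) 8 * a k)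
    (e0 + \sum_(k < K) (2 * E_ k + 40 * (rn * del k.+2 * Theta k.+2))).
Proof.
elim: K c0 e0 => [|K IH] c0 e0 c00; first by rewrite !big_ord0 !addr0.
move=> h; rewrite !big_ord_recr /= !addrA ![_ + \sum_(k < K) _ + _]addrAC.
have aK := a_gt0 K.
apply: IH; first by apply: addr_gt0 => //; exact: mulr_gt0.
have h1 := exp_bounded_add (mulr_gt0 (ltr0n _ 4) aK) (mulr_gt0 (ltr0n _ 4) aK)
  (exp_bounded_A K) (exp_bounded_B K).
have h2 := exp_bounded_add (addr_gt0 (mulr_gt0 (ltr0n _ 4) aK) (mulr_gt0 (ltr0n _ 4) aK)) c00 h1 h.
rewrite (_ : c0 + 8 * a K = 4 * a K + 4 * a K + c0); last ring.
move: h2; apply: exp_bounded_le.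
  by rewrite !addr_gt0// mulr_gt0.
move=> i x /=; have := centered_sum_Rem K i x; have := n_int_B K i; lra.
Qed.

(** The scales [4 * a 0], [4 * a K] and the sum of the [8 * a k] are at most [16 / gam], [16 / gam]
    and [64 / gam]. The levels add up to at most 201 times [gam * n * sg ^ 2], rounded up to 256. *)
Lemma bracketing_exp_bounded :
  exp_bounded P (fun i (x : n.-tuple T) => `|centered_sum P (f i) x|)
    (96 / gam) (256 * gam * (n%:R * sg ^+ 2)).
Proof.
have r0 : 0 < rn * sg ^+ 2 by rewrite mulr_gt0// exprn_gt0.
(* The chain stops where the mean of [F K] costs at most [gam * n * sg ^ 2]. The final constants do
   not involve [K]. *)
have [K hK] : exists K, 9 / 2 * del K <= gam * sg ^+ 2.
  have [K hK] : exists K, 9 / 2 / (gam * sg) < K%:R :> R.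
    exists (Num.truncn (9 / 2 / (gam * sg))).+1; exact: truncnS_gt.
  exists K; rewrite /del mulrA ler_pdivrMr ?exprn_gt0//.
  move: hK; rewrite ltr_pdivrMr ?mulr_gt0// => hK.
  have k2 : K%:R <= 2 ^+ K :> R by rewrite -natrX ler_nat ltnW// ltn_expl.
  have : K%:R * (gam * sg) <= 2 ^+ K * (gam * sg) by rewrite ler_wpM2r// ltW// mulr_gt0.
  have gs : 0 < sg by [].
  move=> h; have := ltW (lt_le_trans hK h); rewrite -(ler_pM2r sg_gt0) => {}h.
  by rewrite (le_trans h)// le_eqVlt; apply/orP; left; apply/eqP; ring.
have aK := a_gt0 K; have a0 := a_gt0 0.
have h1 : exp_bounded P (fun i (x : n.-tuple T) => `|centered_sum P (Rem K i) x|)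
    (4 * a K) (E_ K + gam * (n%:R * sg ^+ 2)).
  move: (exp_bounded_F K); apply: exp_bounded_le; first by rewrite mulr_gt0.
  move=> i x.
  have : `|centered_sum P (Rem K i) x| <=
      `|centered_sum P (F K i) x| + n%:R * \int[P]_x F K i x :> R.
    apply: centered_sum_dominated => // y.
    have /andP[p1 p2] := fl K i y.
    by rewrite /Rem /F /J; case: kept; rewrite ?mulr1 ?mulr0 ?p1 ?lexx.
  have := n_int_F K i.
  have : n%:R * (9 / 2 * del K) <= n%:R * (gam * sg ^+ 2) by rewrite ler_wpM2l.
  lra.
have h2 := exp_bounded_Rem (mulr_gt0 (ltr0n _ 4) aK) h1.
have a8 k : 8 * a k <= 32 / gam * (2 ^+ k)^-1.
  have t0 := Theta_gt0 k.+1; have t1 := Theta_ge k.+1.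
  rewrite /a mulrA ler_pdivrMr//.
  have -> : 8 * (rn * del k) = 32 / gam * (2 ^+ k)^-1 * (gam / 4 * (rn * sg)).
    by rewrite /del; field; rewrite expf_neq0 ?gt_eqF.
  by rewrite ler_wpM2l// mulr_ge0 ?invr_ge0 ?exprn_ge0// divr_ge0// ltW.
have s2 L : \sum_(k < L) (2 ^+ k)^-1 <= 2 :> R.
  have : \sum_(k < L) del k = sg * \sum_(k < L) (2 ^+ k)^-1 by rewrite mulr_sumr.
  by have := sum_del L => + h; rewrite h mulrC ler_pM2r.
have cpos : 0 < 4 * a K + \sum_(k < K) 8 * a k.
  apply: ltr_wpDr; last exact: mulr_gt0.
  by apply: sumr_ge0 => k _; rewrite mulr_ge0// ltW.
have h3 := exp_bounded_add (mulr_gt0 (ltr0n _ 4) a0) cpos exp_bounded_l0 h2.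
have ctot : 4 * a 0 + (4 * a K + \sum_(k < K) 8 * a k) <= 96 / gam.
  have g0 : 0 <= 32 / gam by rewrite divr_ge0// ltW.
  have b0 := a8 0; have bK := a8 K; rewrite expr0 invr1 in b0.
  have bK1 : 32 / gam * (2 ^+ K)^-1 <= 32 / gam * 1.
    by rewrite ler_wpM2l// invf_le1 ?exprn_gt0// exprn_ege1// ler1n.
  have bs : \sum_(k < K) 8 * a k <= 32 / gam * 2.
    apply: (@le_trans _ _ (\sum_(k < K) 32 / gam * (2 ^+ k)^-1)).
      by apply: ler_sum => k _; exact: a8.
    by rewrite -mulr_sumr ler_wpM2l.
  lra.
have := exp_bounded_scale (addr_gt0 (mulr_gt0 (ltr0n _ 4) a0) cpos) ctot h3.
apply: exp_bounded_le; first by rewrite divr_gt0.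
move=> i x.
have Ef : f i = fun x => l 0 i x + Rem 0 i x.
  apply/funext => y; rewrite /Rem /J /= (_ : D 0 i y <= a 0) ?mulr1 1?addrC ?subrK//.
  apply: le_trans a0_ge2.
  have := u_le1 0 i y; have := l_le1 0 i y; rewrite !ler_norml /D.
  by move=> /andP[q1 q2] /andP[q3 q4]; lra.
have -> : `|centered_sum P (f i) x| = `|centered_sum P (l 0 i) x + centered_sum P (Rem 0 i) x| :> R.
  by rewrite {1}Ef centered_sumD.
have tri := ler_normD (centered_sum P (l 0 i) x) (centered_sum P (Rem 0 i) x).
have G k : rn * del k * Theta k <= gam * (n%:R * sg ^+ 2).
  have -> : gam * (n%:R * sg ^+ 2) = rn * (gam * (rn * sg ^+ 2)) by rewrite -rn2; ring.
  by rewrite -mulrA ler_pM2l.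
have EE k : E_ k = 40 * (rn * del k.+1 * Theta k.+1) by rewrite /E_ (delS k); ring.
have GS L : \sum_(k < L) (rn * del k * Theta k) <= gam * (n%:R * sg ^+ 2).
  have -> : gam * (n%:R * sg ^+ 2) = rn * (gam * (rn * sg ^+ 2)) by rewrite -rn2; ring.
  under eq_bigr do rewrite -mulrA.
  by rewrite -mulr_sumr ler_pM2l.
have Gge0 k : 0 <= rn * del k * Theta k by rewrite !mulr_ge0// ltW.
have GS1 : \sum_(k < K) (rn * del k.+1 * Theta k.+1) <= gam * (n%:R * sg ^+ 2).
  by have := GS K.+1; rewrite big_ord_recl /=; have := Gge0 0%N; lra.
have GS2 : \sum_(k < K) (rn * del k.+2 * Theta k.+2) <= gam * (n%:R * sg ^+ 2).
  have := GS K.+2; rewrite !big_ord_recl /=; have := Gge0 0%N; have := Gge0 1%N; lra.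
have -> : \sum_(k < K) (2 * E_ k + 40 * (rn * del k.+2 * Theta k.+2)) =
  80 * \sum_(k < K) (rn * del k.+1 * Theta k.+1) +
  40 * \sum_(k < K) (rn * del k.+2 * Theta k.+2).
  rewrite !mulr_sumr -big_split /=; apply: eq_bigr => k _; rewrite EE; ring.
rewrite !EE.
have G1 := G 1%N; have GK := G K.+1.
have gn0 := le_trans (Gge0 0%N) (G 0%N).
lra.
Qed.

End bracketing_chaining.

(** * The score function *)

Section score.
Context (R : realType).
Implicit Types v w : R.

(* psi (sqrt (v / w)) in closed form; at w = 0 it takes the values that the
   conventions 0 / 0 = 1 and v / 0 = +oo prescribe. *)
Definition score v w : R := (Num.sqrt v - Num.sqrt w) / Num.sqrt (w + v).

Lemma psi_root_ratioE (d : measure_display) (T : measurableType d)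
    (t' t : T -> R) x : 0 <= t' x -> 0 <= t x ->
  psi (root_ratio t' t x) = score (t' x) (t x).
Proof.
move=> t'0 t0; rewrite /root_ratio /score; case: eqVneq => [->|tn0].
  rewrite sqrtr0 subr0 add0r; case: eqVneq => [->|t'n0] /=.
    by rewrite subrr sqrtr0 !mul0r.
  by rewrite divff// gt_eqF// sqrtr_gt0 lt_neqAle eq_sym t'n0.
have tp : 0 < t x by rewrite lt_neqAle eq_sym tn0.
have sp : 0 < Num.sqrt (t x) by rewrite sqrtr_gt0.
have xp : 0 < Num.sqrt (t x + t' x) by rewrite sqrtr_gt0 ltr_wpDr.
rewrite /= sqr_sqrtr ?divr_ge0//.
have -> : 1 + t' x / t x = (t x + t' x) / t x by field.
rewrite !sqrtrM ?addr_ge0// !sqrtrV//.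
by field; rewrite !gt_eqF.
Qed.

Let a2 v : 0 <= v -> Num.sqrt v ^+ 2 = v. Proof. exact: sqr_sqrtr. Qed.

Lemma score_anti v w : score v w = - score w v.
Proof. by rewrite /score [w + v]addrC -mulNr opprB. Qed.

Lemma score_le1 v w : 0 <= v -> 0 <= w -> `|score v w| <= 1.
Proof.
move=> v0 w0; rewrite /score normrM normfV.
have [->|n0] := eqVneq (Num.sqrt (w + v)) 0.
  by rewrite normr0 invr0 mulr0.
have p : 0 < Num.sqrt (w + v) by rewrite lt_neqAle eq_sym n0 sqrtr_ge0.
rewrite (gtr0_norm p) ler_pdivrMr// mul1r.
rewrite -[leRHS](gtr0_norm p) -ler_sqr ?nnegrE// !real_normK ?num_real//.
rewrite a2 ?addr_ge0// sqrrB !a2//.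
have : 0 <= Num.sqrt v * Num.sqrt w by rewrite mulr_ge0.
by rewrite mulr2n; lra.
Qed.

Section increments.
Variables a b c : R.
Hypotheses (a0 : 0 <= a) (ab : a <= b) (c0 : 0 <= c).
Let A := Num.sqrt (c ^+ 2 + a ^+ 2).
Let B := Num.sqrt (c ^+ 2 + b ^+ 2).
Let A0 : 0 <= A. Proof. exact: sqrtr_ge0. Qed.
Let B0 : 0 <= B. Proof. exact: sqrtr_ge0. Qed.
Let A2 : A ^+ 2 = c ^+ 2 + a ^+ 2.
Proof. by rewrite sqr_sqrtr// addr_ge0 ?sqr_ge0. Qed.
Let B2 : B ^+ 2 = c ^+ 2 + b ^+ 2.
Proof. by rewrite sqr_sqrtr// addr_ge0 ?sqr_ge0. Qed.
Let b0 : 0 <= b. Proof. exact: le_trans ab. Qed.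
Let a2b2 : a ^+ 2 <= b ^+ 2. Proof. by rewrite lerXn2r ?nnegrE. Qed.
Let AB : A <= B. Proof. by rewrite ler_sqrt ?addr_ge0 ?sqr_ge0// lerD2l. Qed.
Let aBbA : a * B <= b * A.
Proof.
rewrite -ler_sqr ?nnegrE ?mulr_ge0// !exprMn A2 B2.
have := ler_wpM2r (sqr_ge0 c) a2b2; lra.
Qed.

Let score_incr : (a - c) / A <= (b - c) / B.
Proof.
have [A_0|An0] := eqVneq A 0.
  have := A2; rewrite A_0 expr0n /= => /esym /eqP.
  rewrite paddr_eq0 ?sqr_ge0// !sqrf_eq0 => /andP[/eqP -> _].
  by rewrite invr0 mulr0 subr0 divr_ge0.
have Ap : 0 < A by rewrite lt_neqAle eq_sym An0.
have Bp : 0 < B by exact: lt_le_trans AB.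
rewrite ler_pdivrMr// mulrAC ler_pdivlMr//.
rewrite !mulrBl lerB// ler_wpM2l//.
Qed.

Let score_lip : 0 < c -> ((b - c) / B - (a - c) / A) * c <= 2 * (b - a).
Proof.
move=> cp.
have cA : c <= A.
  by rewrite -ler_sqr ?nnegrE// A2 lerDl sqr_ge0.
have Ap : 0 < A by exact: lt_le_trans cA.
have Bp : 0 < B by exact: lt_le_trans AB.
have aA : a <= A by rewrite -ler_sqr ?nnegrE// A2 lerDr sqr_ge0.
have bB : b <= B by rewrite -ler_sqr ?nnegrE// B2 lerDr sqr_ge0.
have BA : B - A <= b - a.
  rewrite leNgt; apply/negP => h.
  have : (b - a) * (b + a) < (B - A) * (B + A).
    apply: (@le_lt_trans _ _ ((b - a) * (B + A))).
      by rewrite ler_wpM2l ?subr_ge0// lerD.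
    by rewrite ltr_pM2r// addr_gt0.
  have -> : (B - A) * (B + A) = B ^+ 2 - A ^+ 2 by ring.
  by rewrite A2 B2; lra.
have h1 : (b / B - a / A) * c <= b - a.
  have e : a / B <= a / A by rewrite ler_wpM2l// lef_pV2// posrE.
  have cB : c / B <= 1 by rewrite ler_pdivrMr// mul1r (le_trans cA).
  apply: (@le_trans _ _ ((b / B - a / B) * c)).
    by rewrite ler_wpM2r//; lra.
  have -> : (b / B - a / B) * c = (b - a) * (c / B) by ring.
  by rewrite ler_piMr ?subr_ge0.
have h2 : (c / A - c / B) * c <= b - a.
  have cA1 : c / A <= 1 by rewrite ler_pdivrMr// mul1r.
  have cB : c / B <= 1 by rewrite ler_pdivrMr// mul1r (le_trans cA).
  have -> : (c / A - c / B) * c = (B - A) * ((c / A) * (c / B)).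
    by field; rewrite !gt_eqF.
  apply: le_trans BA; rewrite ler_piMr ?subr_ge0//.
  by rewrite mulr_ile1// divr_ge0.
rewrite (_ : _ * c = (b / B - a / A) * c + (c / A - c / B) * c); last ring.
lra.
Qed.

(** Here [a], [b], [c] stand for [sqrt v], [sqrt v'], [sqrt w]. The difference splits into
    [b / B - a / A] and [c / A - c / B]; multiplied by [c], each is at most [b - a], because [c] is
    at most [A] and [B] and because [B - A <= b - a]. *)
Lemma score_increment : (a - c) / A <= (b - c) / B /\
  c ^+ 2 * ((b - c) / B - (a - c) / A) ^+ 2 <= 4 * (b - a) ^+ 2.
Proof.
split; first exact: score_incr.
have [->|cn0] := eqVneq c 0; first by rewrite expr0n /= mul0r mulr_ge0 ?sqr_ge0.
have cp : 0 < c by rewrite lt_neqAle eq_sym cn0.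
have -> : 4 * (b - a) ^+ 2 = (2 * (b - a)) ^+ 2 by ring.
rewrite -exprMn lerXn2r ?nnegrE//.
- by rewrite mulr_ge0// subr_ge0 score_incr.
- by rewrite mulr_ge0// subr_ge0.
- by rewrite mulrC score_lip.
Qed.

End increments.

Let sqrt_add v w : 0 <= v -> 0 <= w ->
  Num.sqrt (w + v) = Num.sqrt (Num.sqrt w ^+ 2 + Num.sqrt v ^+ 2).
Proof. by move=> v0 w0; rewrite !a2. Qed.

Lemma score_le v v' w : 0 <= v -> v <= v' -> 0 <= w -> score v w <= score v' w.
Proof.
move=> v0 vv' w0; have v'0 : 0 <= v' by exact: le_trans vv'.
rewrite /score (sqrt_add v0 w0) (sqrt_add v'0 w0).
by have [] := score_increment (sqrtr_ge0 v) (ler_wsqrtr vv') (sqrtr_ge0 w).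
Qed.

(** The factor [w] is the density under which second moments are taken. With the monotonicity of the
    score, this turns Hellinger brackets into mean-square brackets for the scores. *)
Lemma score_lipschitz v v' w : 0 <= v -> v <= v' -> 0 <= w ->
  w * (score v' w - score v w) ^+ 2 <= 4 * (Num.sqrt v' - Num.sqrt v) ^+ 2.
Proof.
move=> v0 vv' w0; have v'0 : 0 <= v' by exact: le_trans vv'.
rewrite /score (sqrt_add v0 w0) (sqrt_add v'0 w0) -[w in w * _](a2 w0).
by have [] := score_increment (sqrtr_ge0 v) (ler_wsqrtr vv') (sqrtr_ge0 w).
Qed.

Lemma score_sqr_le v w : 0 <= v -> 0 <= w ->
  w * score v w ^+ 2 <= (Num.sqrt v - Num.sqrt w) ^+ 2.
Proof.
move=> v0 w0; rewrite /score exprMn exprVn a2 ?addr_ge0//.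
have [->|n0] := eqVneq (w + v) 0; first by rewrite invr0 !mulr0 sqr_ge0.
have p : 0 < w + v by rewrite lt_neqAle eq_sym n0 addr_ge0.
rewrite mulrA ler_pdivrMr// mulrC ler_wpM2l ?sqr_ge0//; lra.
Qed.

(* With a = sqrt w, b = sqrt v, r = sqrt (w + v), the claim reduces to
   (b - a) ((5a + 3b) sqrt 2 r - 4 (3a^2 + b^2)) >= 0, and the difference of the
   squares of the two terms is 2 (b - a) (b^3 + 31ab^2 + 17a^2b + 47a^3). *)
Lemma score_drift v w : 0 <= v -> 0 <= w ->
  2^-1 * (Num.sqrt (v * ((w + v) / 2)) - Num.sqrt (w * ((w + v) / 2))) +
    (Num.sqrt 2)^-1 * (score v w * w) <=
  2^-1 * (v - w) - 8^-1 * (Num.sqrt v - Num.sqrt w) ^+ 2.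
Proof.
move=> v0 w0; rewrite /score.
have wv0 : 0 <= w + v by rewrite addr_ge0.
rewrite !sqrtrM// sqrtrV//.
set a := Num.sqrt w; set b := Num.sqrt v; set r := Num.sqrt (w + v).
set q : R := Num.sqrt 2.
have q0 : 0 < q by rewrite sqrtr_gt0.
have qq : q ^+ 2 = 2 by rewrite a2.
have aw : w = a ^+ 2 by rewrite a2.
have bv : v = b ^+ 2 by rewrite a2.
have rr : r ^+ 2 = a ^+ 2 + b ^+ 2 by rewrite a2// aw bv.
have ap : 0 <= a by exact: sqrtr_ge0.
have bp : 0 <= b by exact: sqrtr_ge0.
have rp : 0 <= r by exact: sqrtr_ge0.
rewrite [in X in X * w]/r -/r aw bv.
have [r_0|rn0] := eqVneq r 0.
  have := rr; rewrite r_0 expr0n /= => /esym /eqP.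
  rewrite paddr_eq0 ?sqr_ge0// !sqrf_eq0 => /andP[/eqP -> /eqP ->].
  by rewrite !(mul0r, mulr0, subrr, expr0n) /= !(mul0r, mulr0, subrr, addr0).
have rpos : 0 < r by rewrite lt_neqAle eq_sym rn0.
rewrite -subr_ge0.
have -> : 2^-1 * (b ^+ 2 - a ^+ 2) - 8^-1 * (b - a) ^+ 2 -
    (2^-1 * (b * (r / q) - a * (r / q)) + q^-1 * ((b - a) / r * a ^+ 2)) =
    (b - a) * ((5 * a + 3 * b) * (q * r) - 4 * (2 * a ^+ 2 + r ^+ 2)) / (8 * q * r).
  by field; rewrite !gt_eqF.
rewrite rr divr_ge0//; last by rewrite !mulr_ge0// ltW.
set U := (5 * a + 3 * b) * (q * r); set V := 4 * _.
have U0 : 0 <= U.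
  by apply: mulr_ge0; [lra|rewrite mulr_ge0// ltW].
have V0 : 0 <= V by have := sqr_ge0 a; have := sqr_ge0 b; rewrite /V; lra.
have UV : U ^+ 2 - V ^+ 2 =
  (b - a) * (2 * (b ^+ 3 + 31 * (a * b ^+ 2) + 17 * (a ^+ 2 * b) + 47 * a ^+ 3)).
  by rewrite /U /V !exprMn qq rr; ring.
set W := 2 * _ in UV.
have W0 : 0 <= W.
  have : 0 <= a * b ^+ 2 by rewrite mulr_ge0// sqr_ge0.
  have : 0 <= a ^+ 2 * b by rewrite mulr_ge0// sqr_ge0.
  have := exprn_ge0 3 ap; have := exprn_ge0 3 bp; rewrite /W; lra.
have [h|h] := leP a b.
  rewrite mulr_ge0 ?subr_ge0// -ler_sqr ?nnegrE// -subr_ge0 UV.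
  by rewrite mulr_ge0// subr_ge0.
rewrite mulr_le0 ?subr_le0//; first exact: ltW.
rewrite -ler_sqr ?nnegrE// -subr_le0 UV mulr_le0_ge0// subr_le0; exact: ltW.
Qed.

End score.

(** * Hellinger distance and Kullback-Leibler divergence *)

Section density_divergences.
Context (d : measure_display) (T : measurableType d) (R : realType)
  (mu : {measure set T -> \bar R}).
Implicit Types s t : density mu.

Lemma ge0_integral_fin_integrable (f : T -> R) (B : R) :
  measurable_fun setT f -> (forall x, 0 <= f x) ->
  (\int[mu]_x (f x)%:E <= B%:E)%E -> mu.-integrable setT (EFin \o f).
Proof.
move=> mf f0 fB; apply/integrableP; split; first exact/measurable_EFinP.
apply: le_lt_trans (ltry B); apply: le_trans fB.
rewrite le_eqVlt; apply/orP; left; apply/eqP; apply: eq_integral => x _ /=.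
by rewrite ger0_norm.
Qed.

Lemma integrable_addr (f g : T -> R) : mu.-integrable setT (EFin \o f) ->
  mu.-integrable setT (EFin \o g) ->
  mu.-integrable setT (EFin \o (fun x => f x + g x)).
Proof. by move=> fi gi; exact: (integrableD measurableT fi gi). Qed.

Lemma integrable_mulrl (f : T -> R) r : mu.-integrable setT (EFin \o f) ->
  mu.-integrable setT (EFin \o (fun x => r * f x)).
Proof. by move=> fi; exact: (integrableZl measurableT r fi). Qed.

Lemma integrable_subr (f g : T -> R) : mu.-integrable setT (EFin \o f) ->
  mu.-integrable setT (EFin \o g) ->
  mu.-integrable setT (EFin \o (fun x => f x - g x)).
Proof. by move=> fi gi; exact: (integrableB measurableT fi gi). Qed.

Lemma measurable_invr_ge0 (f : T -> R) : measurable_fun setT f ->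
  (forall x, 0 <= f x) -> measurable_fun setT (fun x => (f x)^-1).
Proof.
move=> mf f0; rewrite (_ : (fun x => _) = (fun x => f x `^ (-1))).
  exact: (measurableT_comp (measurable_powR _) mf).
by apply/funext => x; rewrite powR_inv1.
Qed.

Lemma density_integrable s : mu.-integrable setT (EFin \o s).
Proof.
apply: (@ge0_integral_fin_integrable _ 1); first exact: density_measurable.
  exact: density_ge0.
by rewrite density_int1.
Qed.

Lemma Rintegral_density s : \int[mu]_x s x = 1.
Proof. by rewrite /Rintegral density_int1. Qed.

Lemma measurable_sqrt_comp (f : T -> R) : measurable_fun setT f ->
  measurable_fun setT (fun x => Num.sqrt (f x)).
Proof.
move=> mf; apply: (@measurableT_comp _ _ _ _ _ _ (@Num.sqrt R)) => //.
by apply: continuous_measurable_fun; exact: sqrt_continuous.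
Qed.

Let mdens s : measurable_fun setT s.
Proof. exact: density_measurable. Qed.

Lemma measurable_hellinger_integrand (f g : T -> R) :
  measurable_fun setT f -> measurable_fun setT g ->
  measurable_fun setT (fun x => (Num.sqrt (f x) - Num.sqrt (g x)) ^+ 2).
Proof.
move=> mf mg; apply: measurable_funX; apply: measurable_funB;
  exact: measurable_sqrt_comp.
Qed.

Lemma sqr_sqrtB_le (v w : R) : 0 <= v -> 0 <= w ->
  (Num.sqrt v - Num.sqrt w) ^+ 2 <= v + w.
Proof.
move=> v0 w0; rewrite sqrrB !sqr_sqrtr//.
have : 0 <= Num.sqrt v * Num.sqrt w by rewrite mulr_ge0.
by rewrite mulr2n; lra.
Qed.

Lemma integrable_hellinger s t : mu.-integrable setT
  (EFin \o (fun x => (Num.sqrt (s x) - Num.sqrt (t x)) ^+ 2)).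
Proof.
apply: (@le_integrable _ _ _ _ _ _ _ (EFin \o (fun x => s x + t x))) => //.
- by apply/measurable_EFinP; exact: measurable_hellinger_integrand.
- move=> x _ /=; rewrite lee_fin ger0_norm ?sqr_ge0// ger0_norm.
    by apply: sqr_sqrtB_le; exact: density_ge0.
  by rewrite addr_ge0// density_ge0.
- by apply: (@integrableD _ _ _ _ _ measurableT (EFin \o s) (EFin \o t));
    exact: density_integrable.
Qed.

Lemma hellinger_sqrE s t : hellinger s t ^+ 2 =
  2^-1 * \int[mu]_x ((Num.sqrt (s x) - Num.sqrt (t x)) ^+ 2).
Proof.
have i0 : 0 <= \int[mu]_x ((Num.sqrt (s x) - Num.sqrt (t x)) ^+ 2).
  by apply: Rintegral_ge0 => x _; exact: sqr_ge0.
have e : (2^-1 * \int[mu]_x ((Num.sqrt (s x) - Num.sqrt (t x)) ^+ 2))%:E =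
    hellinger_sq mu s t.
  rewrite /hellinger_sq EFinM fineK//.
  exact: (integrable_fin_num measurableT (integrable_hellinger s t)).
by rewrite /hellinger sqr_sqrtr -e //= mulr_ge0.
Qed.

Lemma hellinger_ge0 s t : 0 <= hellinger s t.
Proof. exact: sqrtr_ge0. Qed.

Lemma hellinger_sqr_le1 s t : hellinger s t ^+ 2 <= 1.
Proof.
rewrite hellinger_sqrE.
have : \int[mu]_x ((Num.sqrt (s x) - Num.sqrt (t x)) ^+ 2) <=
    \int[mu]_x (s x + t x).
  apply: le_Rintegral => //; first exact: integrable_hellinger.
    by apply: (@integrableD _ _ _ _ _ measurableT (EFin \o s) (EFin \o t));
      exact: density_integrable.
  by move=> x _; apply: sqr_sqrtB_le; exact: density_ge0.
rewrite RintegralD//; [|exact: density_integrable|exact: density_integrable].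
rewrite !Rintegral_density; lra.
Qed.

Lemma hellinger_self s : hellinger s s = 0.
Proof.
apply/eqP; rewrite -sqrf_eq0 hellinger_sqrE.
under eq_Rintegral do rewrite subrr expr0n /=.
by rewrite Rintegral_cst//= mul0r mulr0.
Qed.

Lemma hellinger_sqr_triangle s t r :
  hellinger s r ^+ 2 <= 2 * hellinger s t ^+ 2 + 2 * hellinger t r ^+ 2.
Proof.
rewrite !hellinger_sqrE.
have i1 := integrable_hellinger s t; have i2 := integrable_hellinger t r.
set f := fun x => (Num.sqrt (s x) - Num.sqrt (t x)) ^+ 2 in i1 *.
set g := fun x => (Num.sqrt (t x) - Num.sqrt (r x)) ^+ 2 in i2 *.
have i1' : mu.-integrable setT (EFin \o (fun x => 2 * f x)).
  by have := integrableZl measurableT 2 i1.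
have i2' : mu.-integrable setT (EFin \o (fun x => 2 * g x)).
  by have := integrableZl measurableT 2 i2.
have : \int[mu]_x ((Num.sqrt (s x) - Num.sqrt (r x)) ^+ 2) <=
    \int[mu]_x (2 * f x + 2 * g x).
  apply: le_Rintegral => //; first exact: integrable_hellinger.
    exact: (integrableD measurableT i1' i2').
  move=> x _; rewrite /f /g.
  have := sqr_ge0 (Num.sqrt (s x) - Num.sqrt (t x) - (Num.sqrt (t x) - Num.sqrt (r x))).
  rewrite !expr2; lra.
rewrite RintegralD// !RintegralZl//; lra.
Qed.

Lemma bounded_mfun_score (f : T -> R) s : measurable_fun setT f ->
  (forall x, 0 <= f x) -> bounded_mfun (fun x => score (f x) (s x)).
Proof.
move=> mf f0; split; last first.
  by exists 1 => x; apply: score_le1 => //; exact: density_ge0.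
apply: measurable_funM.
  by apply: measurable_funB; exact: measurable_sqrt_comp.
apply: measurable_invr_ge0 => [|x]; last exact: sqrtr_ge0.
by apply: measurable_sqrt_comp; exact: measurable_funD.
Qed.

Lemma Rintegral_density_law s (f : T -> R) : measurable_fun setT f ->
  \int[density_law s]_x f x = \int[mu]_x (f x * s x).
Proof. by move=> mf; rewrite /Rintegral integral_density_law. Qed.

Lemma integrable_bounded_density s (f : T -> R) : bounded_mfun f ->
  mu.-integrable setT (EFin \o (fun x => f x * s x)).
Proof.
move=> [mf [B fB]].
apply: (@le_integrable _ _ _ _ _ _ _ (EFin \o (fun x => B * s x))) => //.
- by apply/measurable_EFinP; exact: measurable_funM.
- move=> x _ /=; have B0 : 0 <= B by exact: le_trans (fB x).
  rewrite lee_fin !normrM (ger0_norm B0) (ger0_norm (density_ge0 s x)).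
  by rewrite ler_wpM2r// density_ge0.
- by have := integrableZl measurableT B (density_integrable s).
Qed.

Lemma score_second_moment s t :
  \int[density_law s]_x (score (t x) (s x) ^+ 2) <= 2 * hellinger s t ^+ 2.
Proof.
have bs : bounded_mfun (fun x => score (t x) (s x) ^+ 2).
  by apply: bounded_mfunX; apply: bounded_mfun_score => // x; exact: density_ge0.
rewrite Rintegral_density_law; last by have [] := bs.
rewrite hellinger_sqrE mulVKf//; apply: le_Rintegral => //.
- exact: integrable_bounded_density.
- exact: integrable_hellinger.
- move=> x _; rewrite mulrC -[leRHS]sqrrN opprB.
  by apply: score_sqr_le; exact: density_ge0.
Qed.

Lemma score_bracket_second_moment s (f g : T -> R) (z : R) :
  measurable_fun setT f -> measurable_fun setT g ->
  (forall x, 0 <= f x) -> (forall x, f x <= g x) ->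
  (hellinger_sq mu g f <= (z ^+ 2)%:E)%E ->
  \int[density_law s]_x ((score (g x) (s x) - score (f x) (s x)) ^+ 2) <=
    8 * z ^+ 2.
Proof.
move=> mf mg f0 fg fgz.
have g0 x : 0 <= g x by exact: le_trans (fg x).
have bs : bounded_mfun (fun x => (score (g x) (s x) - score (f x) (s x)) ^+ 2).
  by apply: bounded_mfunX; apply: bounded_mfunB; exact: bounded_mfun_score.
rewrite -lee_fin Rintegral_boundedE// integral_density_law; last by have [] := bs.
have mh := measurable_hellinger_integrand mg mf.
apply: (@le_trans _ _ (\int[mu]_x (4 * (Num.sqrt (g x) - Num.sqrt (f x)) ^+ 2)%:E)%E).
  apply: ge0_le_integralT => x; rewrite lee_fin.
    by rewrite mulr_ge0 ?sqr_ge0// density_ge0.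
  by rewrite mulrC; apply: score_lipschitz => //; exact: density_ge0.
under eq_integral do rewrite EFinM.
rewrite ge0_integralZl_EFin//; last 2 first.
- by move=> x _; rewrite lee_fin sqr_ge0.
- exact/measurable_EFinP.
move: fgz; rewrite /hellinger_sq.
have : (0 <= \int[mu]_x ((Num.sqrt (g x) - Num.sqrt (f x)) ^+ 2)%:E)%E.
  by apply: integral_ge0 => x _; rewrite lee_fin sqr_ge0.
(* The ends of a bracket are not densities, so finiteness is not automatic; [fgz] excludes the
   infinite case. *)
case: (\int[mu]_x _)%E => [r _| _|] //=.
- rewrite -!EFinM !lee_fin; lra.
- by rewrite gt0_muley// lte_fin invr_gt0.
Qed.

Lemma TstatC n (x : n.-tuple T) s t : Tstat x t s = - Tstat x s t.
Proof.
rewrite /Tstat (_ : (fun z => (t z + s z) / 2) = (fun z => (s z + t z) / 2)); last first.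
  by apply/funext => z; rewrite addrC.
rewrite opprD -mulrN opprB -mulrN -sumrN; congr (_ + _ * _).
apply: eq_bigr => i _; rewrite !psi_root_ratioE ?density_ge0//.
by rewrite score_anti.
Qed.

(** [score_drift] integrated against [mu]: the term [2^-1 * (v - w)] vanishes because both functions
    are densities, and the squared term integrates to a quarter of the squared Hellinger
    distance. *)
Lemma Tstat_le n (x : n.-tuple T) s t :
  Tstat x s t <= - (4^-1 * (n%:R * hellinger s t ^+ 2)) +
    (Num.sqrt 2)^-1 *
      centered_sum (density_law s) (fun y => score (t y) (s y)) x.
Proof.
rewrite /Tstat /centered_sum.
under eq_bigr do rewrite psi_root_ratioE ?density_ge0//.
have bs : bounded_mfun (fun y => score (t y) (s y)).
  by apply: bounded_mfun_score => // y; exact: density_ge0.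
set S := \sum_(i < n) _.
set e := \int[density_law s]_y _.
set q := (Num.sqrt 2)^-1.
set r := fun z => (s z + t z) / 2.
suff H : 2^-1 * (affinity mu t r - affinity mu s r) + q * e <=
    - (4^-1 * hellinger s t ^+ 2).
  have n0 : 0 <= n%:R :> R by [].
  have := ler_wpM2l n0 H; lra.
have r0 y : 0 <= r y by rewrite divr_ge0// addr_ge0// density_ge0.
have mr : measurable_fun setT r.
  by apply: measurable_funM => //; exact: measurable_funD.
have ist : mu.-integrable setT (EFin \o (fun x => s x + t x)).
  by apply: (@integrableD _ _ _ _ _ measurableT (EFin \o s) (EFin \o t));
    exact: density_integrable.
have ia u : (forall y, 0 <= u y <= s y + t y) -> measurable_fun setT u ->
    mu.-integrable setT (EFin \o (fun y => Num.sqrt (u y * r y))).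
  move=> ust mum.
  apply: (@le_integrable _ _ _ _ _ _ _ (EFin \o (fun x => s x + t x))) => //.
    by apply/measurable_EFinP; apply: measurable_sqrt_comp; exact: measurable_funM.
  move=> y _ /=; have /andP[u0 u1] := ust y.
  have st0 : 0 <= s y + t y by exact: le_trans u1.
  have r_0 := r0 y; rewrite lee_fin !ger0_norm// ?sqrtr_ge0//.
  rewrite -ler_sqr ?nnegrE ?sqrtr_ge0// sqr_sqrtr ?mulr_ge0//.
  apply: (@le_trans _ _ ((s y + t y) * r y)); first by rewrite ler_wpM2r.
  by rewrite expr2 ler_wpM2l// /r; lra.
have iat : mu.-integrable setT (EFin \o (fun y => Num.sqrt (t y * r y))).
  by apply: ia => // y; rewrite density_ge0 lerDr density_ge0.
have ias : mu.-integrable setT (EFin \o (fun y => Num.sqrt (s y * r y))).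
  by apply: ia => // y; rewrite density_ge0 lerDl density_ge0.
have isc : mu.-integrable setT (EFin \o (fun y => score (t y) (s y) * s y)).
  exact: integrable_bounded_density.
have il : mu.-integrable setT (EFin \o (fun y =>
    2^-1 * (Num.sqrt (t y * r y) - Num.sqrt (s y * r y)) +
    q * (score (t y) (s y) * s y))).
  apply: integrable_addr; apply: integrable_mulrl => //.
  exact: integrable_subr.
have iu : mu.-integrable setT (EFin \o (fun y =>
    2^-1 * (t y - s y) - 8^-1 * (Num.sqrt (s y) - Num.sqrt (t y)) ^+ 2)).
  apply: integrable_subr; apply: integrable_mulrl; last exact: integrable_hellinger.
  by apply: integrable_subr; exact: density_integrable.
have : \int[mu]_y (2^-1 * (Num.sqrt (t y * r y) - Num.sqrt (s y * r y)) +
    q * (score (t y) (s y) * s y)) <=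
    \int[mu]_y (2^-1 * (t y - s y) - 8^-1 * (Num.sqrt (s y) - Num.sqrt (t y)) ^+ 2).
  apply: le_Rintegral => // y _.
  rewrite -[X in _ - 8^-1 * X]sqrrN opprB.
  by apply: score_drift; exact: density_ge0.
rewrite RintegralD//; [|by apply: integrable_mulrl; exact: integrable_subr
  |exact: integrable_mulrl].
rewrite RintegralZl//; last exact: integrable_subr.
rewrite RintegralZl// RintegralB//.
rewrite RintegralB//; [|by apply: integrable_mulrl; apply: integrable_subr;
    exact: density_integrable
  |by apply: integrable_mulrl; exact: integrable_hellinger].
rewrite RintegralZl//; last by apply: integrable_subr; exact: density_integrable.
rewrite RintegralZl//; last exact: integrable_hellinger.
rewrite RintegralB//; [|exact: density_integrable|exact: density_integrable].
rewrite !Rintegral_density hellinger_sqrE /affinity /e.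
rewrite Rintegral_density_law; last by have [] := bs.
lra.
Qed.

Lemma ln_le_subr1 (x : R) : 0 < x -> ln x <= x - 1.
Proof.
move=> x0; have := @le_ln1Dx R (x - 1).
by rewrite (_ : 1 + (x - 1) = x); [apply; lra|ring].
Qed.

(** [ln x <= x - 1] at [x = sqrt (b / a)], with [ln (a / b) = - 2 * ln x]. *)
Lemma kl_integrand_ge (a b : R) : 0 <= a -> 0 < b ->
  2 * a - 2 * (Num.sqrt a * Num.sqrt b) <= a * ln (a / b).
Proof.
move=> a0 b0; have [->|an0] := eqVneq a 0.
  by rewrite sqrtr0 !mul0r !mulr0 subrr.
have ap : 0 < a by rewrite lt_neqAle eq_sym an0.
have sa : 0 < Num.sqrt a by rewrite sqrtr_gt0.
have sb : 0 < Num.sqrt b by rewrite sqrtr_gt0.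
have -> : a / b = ((Num.sqrt b / Num.sqrt a) ^+ 2)^-1.
  by rewrite exprMn exprVn !sqr_sqrtr ?ltW// invfM invrK mulrC.
have x0 : 0 < Num.sqrt b / Num.sqrt a by rewrite divr_gt0.
rewrite lnV ?posrE ?exprn_gt0// lnXn//.
have := ler_wpM2l a0 (ln_le_subr1 x0).
have -> : a * (Num.sqrt b / Num.sqrt a - 1) = Num.sqrt a * Num.sqrt b - a.
  have ea : a = Num.sqrt a ^+ 2 by rewrite sqr_sqrtr.
  move: sa ea; set x := Num.sqrt a => sa ea.
  by rewrite ea; field; rewrite gt_eqF.
by rewrite mulr2n; lra.
Qed.

(** [ln x <= x - 1] at [x = V * b / (c * a)]. When [c] is the mean of [V] under the density [b], the
    last two terms cancel after integration. *)
Lemma dv_integrand_le (a b V c : R) : 0 <= a -> 0 < b -> 0 < V -> 0 < c ->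
  a * ln V <= a * ln (a / b) + a * ln c + V * b / c - a.
Proof.
move=> a0 b0 V0 c0; have [->|an0] := eqVneq a 0.
  by rewrite !mul0r !add0r subr0 divr_ge0// ltW// mulr_gt0.
have ap : 0 < a by rewrite lt_neqAle eq_sym an0.
have x0 : 0 < V * b / (c * a) by rewrite divr_gt0// mulr_gt0.
have := ler_wpM2l a0 (ln_le_subr1 x0).
have -> : a * (V * b / (c * a) - 1) = V * b / c - a by field; rewrite !gt_eqF.
have -> : ln (V * b / (c * a)) = ln V + ln b - (ln c + ln a).
  by rewrite ln_div ?posrE ?mulr_gt0// !lnM ?posrE.
rewrite ln_div ?posrE//; lra.
Qed.

(** * Consequences of a finite Kullback-Leibler divergence *)

Section finite_kullback.
Variables s t : density mu.
Hypothesis Kfin : (kullback s t < +oo)%E.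

Let k x := s x * ln (s x / t x).
(** A correction on the set [t = 0], where [k] takes the default value 0 and says nothing about [s].
    Absolute continuity makes its integral zero, so any multiple of it may be added to an upper
    bound. *)
Let u x : R := s x * \1_[set x | t x = 0] x.

Let st : density_law s `<< density_law t.
Proof. by move: Kfin; rewrite /kullback; case: asboolP. Qed.

Let KE : kullback s t = (\int[mu]_x (k x)%:E)%E.
Proof. by rewrite /kullback; case: asboolP. Qed.

Let mZ : measurable [set x | t x = 0].
Proof.
rewrite -[X in measurable X]setTI.
exact: (mdens t measurableT (measurable_set1 0)).
Qed.

Let mk : measurable_fun setT k.
Proof.
apply: measurable_funM => //; apply: measurableT_comp; first exact: measurable_ln.
apply: measurable_funM => //; apply: measurable_invr_ge0 => // x.
exact: density_ge0.
Qed.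

Let t_pos x : t x != 0 -> 0 < t x.
Proof. by move=> tn0; rewrite lt_neqAle eq_sym tn0 density_ge0. Qed.

Let k_ge x : - t x <= k x.
Proof.
have s0 := density_ge0 s x; have t0 := density_ge0 t x; rewrite /k.
have [->|/t_pos tp] := eqVneq (t x) 0; first by rewrite invr0 mulr0 ln0// mulr0 oppr0.
have := kl_integrand_ge s0 tp.
have := sqr_sqrtB_le s0 t0; rewrite sqrrB !sqr_sqrtr// mulr2n.
have := sqr_ge0 (Num.sqrt (s x) - Num.sqrt (t x)).
rewrite sqrrB !sqr_sqrtr// mulr2n; lra.
Qed.

(** [k >= - t] makes the negative part integrable; the integral below [+oo] then forces the positive
    part to be integrable too. *)
Let integrable_k : mu.-integrable setT (EFin \o k).
Proof.
have mkE : measurable_fun setT (EFin \o k) by apply/measurable_EFinP.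
have neg : (\int[mu]_x ((EFin \o k)^\- x) < +oo)%E.
  apply: (@le_lt_trans _ _ (\int[mu]_x (t x)%:E)%E); last first.
    by rewrite density_int1 ltry.
  apply: ge0_le_integralT => x; first exact: funeneg_ge0.
  rewrite funenegE /= -EFin_max lee_fin ge_max density_ge0 andbT.
  by rewrite lerNl; exact: k_ge.
have pos : (\int[mu]_x ((EFin \o k)^\+ x) < +oo)%E.
  pose p := (\int[mu]_x ((EFin \o k)^\+ x))%E.
  pose q := (\int[mu]_x ((EFin \o k)^\- x))%E.
  have h : (p - q < +oo)%E by move: Kfin; rewrite KE integralE.
  have qf : q \is a fin_num by rewrite ge0_fin_numE// integral_ge0.
  by rewrite -/p; move: h; rewrite -(fineK qf); case: p => [r _| |] //=; rewrite ltry.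
apply/integrableP; split=> //.
under eq_integral => x _.
  rewrite (_ : `|(EFin \o k) x|%E = ((EFin \o k)^\+ x + (EFin \o k)^\- x)%E); last first.
    by rewrite -[LHS]/((abse \o (EFin \o k)) x) fune_abse.
  over.
rewrite ge0_integralD//; [exact: lte_add_pinfty| |].
- exact: measurable_funepos.
- exact: measurable_funeneg.
Qed.

Lemma kullbackE : kullback s t = (\int[mu]_x (s x * ln (s x / t x)))%:E.
Proof.
rewrite KE fineK//; exact: (integrable_fin_num measurableT integrable_k).
Qed.

Let bu : bounded_mfun (\1_[set x | t x = 0] : T -> R).
Proof.
split; first exact: measurable_indic.
exists 1 => x; rewrite indicE; case: (_ \in _); by rewrite ?normr1 ?normr0.
Qed.

Let integrable_u : mu.-integrable setT (EFin \o u).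
Proof.
rewrite (_ : u = fun x => \1_[set x | t x = 0] x * s x).
  exact: integrable_bounded_density.
by apply/funext => x; rewrite /u mulrC.
Qed.

Let int_u : \int[mu]_x u x = 0.
Proof.
have t0 : density_law t [set x | t x = 0] = 0%E.
  by rewrite /= /density_law; apply: integral0_eq => x /= ->.
have s0 : density_law s [set x | t x = 0] = 0%E.
  apply/(measure0_null_setP _ mZ)/st; exact/(measure0_null_setP _ mZ).
have -> : u = fun x => \1_[set x | t x = 0] x * s x.
  by apply/funext => x; rewrite /u mulrC.
rewrite -Rintegral_density_law; last by have [] := bu.
rewrite /Rintegral (integral_indic _ measurableT mZ) setIT.
exact: (congr1 fine s0).
Qed.

Lemma hellinger_sqr_le_kullback :
  2 * hellinger s t ^+ 2 <= \int[mu]_x (s x * ln (s x / t x)).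
Proof.
rewrite hellinger_sqrE mulVKf//.
have ist := integrable_subr (density_integrable t) (density_integrable s).
have ik := integrable_addr integrable_k ist.
have i2 := integrable_mulrl 2 integrable_u.
(* On [t = 0] the left integrand is [s] while [k + (t - s)] is [- s]; this gap is the coefficient 2
   of [u]. *)
have : \int[mu]_x ((Num.sqrt (s x) - Num.sqrt (t x)) ^+ 2) <=
    \int[mu]_x (k x + (t x - s x) + 2 * u x).
  apply: le_Rintegral => //; [exact: integrable_hellinger|exact: integrable_addr|].
  move=> x _; have s0 := density_ge0 s x; have t0 := density_ge0 t x; rewrite /k /u indicE.
  have [tx|tn0] := eqVneq (t x) 0.
    rewrite mem_set//= tx invr0 mulr0 ln0// mulr0 sqrtr0 subr0 sqr_sqrtr//; lra.
  rewrite memNset/=; last exact/eqP.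
  have := kl_integrand_ge s0 (t_pos tn0); rewrite sqrrB !sqr_sqrtr// mulr2n; lra.
rewrite (RintegralD measurableT ik i2) (RintegralD measurableT integrable_k ist).
rewrite (RintegralB measurableT (density_integrable t) (density_integrable s)).
rewrite (RintegralZl 2 measurableT integrable_u) int_u !Rintegral_density.
by rewrite subrr mulr0 !addr0.
Qed.

Lemma donsker_varadhan (V : T -> R) B : measurable_fun setT V ->
  (forall x, 1 <= V x <= B) ->
  (\int[density_law s]_x (ln (V x))%:E <=
   (\int[mu]_x (s x * ln (s x / t x)) + ln (\int[density_law t]_x V x))%:E)%E.
Proof.
move=> mV VB; have bV := bounded_mfun_itv mV VB.
have V1 x : 1 <= V x by have /andP[] := VB x.
have V0 x : 0 < V x by exact: lt_le_trans (V1 x).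
have lnV0 x : 0 <= ln (V x) by exact: ln_ge0.
have lnVB x : ln (V x) <= ln B.
  have /andP[_ h] := VB x; rewrite ler_ln ?posrE//; exact: lt_le_trans h.
have blnV : bounded_mfun (fun x => ln (V x)) by exact: bounded_mfun_ln VB.
set c := \int[density_law t]_x V x.
have c1 : 1 <= c.
  rewrite -[1](Rintegral_prob_cst (density_law t)).
  by apply: le_Rintegral_bounded => //; exact: bounded_mfun_cst.
have c0 : 0 < c by exact: lt_le_trans c1.
have lnc : 0 <= ln c by exact: ln_ge0.
rewrite -Rintegral_boundedE// lee_fin Rintegral_density_law; last by have [] := blnV.
have i1 := integrable_addr integrable_k (integrable_mulrl (ln c) (density_integrable s)).
have iVt : mu.-integrable setT (EFin \o (fun x => c^-1 * (V x * t x))).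
  by apply: integrable_mulrl; exact: integrable_bounded_density.
have i2 := integrable_subr iVt (density_integrable s).
(* On [t = 0] the correction has to cover [ln V <= ln B] and the term [- s]. *)
have i3 := integrable_mulrl (ln B + 1) integrable_u.
have i12 := integrable_addr i1 i2.
have : \int[mu]_x (ln (V x) * s x) <=
    \int[mu]_x ((k x + ln c * s x) + (c^-1 * (V x * t x) - s x) + (ln B + 1) * u x).
  apply: le_Rintegral => //; [exact: integrable_bounded_density|exact: integrable_addr|].
  move=> x _; have s0 := density_ge0 s x; have t0 := density_ge0 t x; rewrite /k /u indicE.
  have [tx|tn0] := eqVneq (t x) 0.
    rewrite mem_set//= tx invr0 !(mulr0, mulr1) (@ln0 R 0 (lexx _)) mulr0.
    have := ler_wpM2r s0 (lnVB x); have := mulr_ge0 lnc s0; lra.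
  rewrite memNset/=; last exact/eqP.
  have := dv_integrand_le s0 (t_pos tn0) (V0 x) c0; lra.
have is_ := density_integrable s.
have isc := integrable_mulrl (ln c) is_.
have iV := integrable_bounded_density t bV.
rewrite (RintegralD measurableT i12 i3) (RintegralZl _ measurableT integrable_u).
rewrite (RintegralD measurableT i1 i2) (RintegralD measurableT integrable_k isc).
rewrite (RintegralB measurableT iVt is_) (RintegralZl _ measurableT is_).
rewrite (RintegralZl _ measurableT iV).
rewrite -(Rintegral_density_law t mV) -/c mulVf ?gt_eqF// !Rintegral_density.
by rewrite int_u mulr0 addr0 mulr1 subrr addr0.
Qed.

End finite_kullback.

End density_divergences.

(** * Entropy bounds and peeling *)

(** The sum is twice a lower Riemann sum: the cell []del k.+1, del k[] has length [del k / 2], and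
    [g >= g (del k)] on it. *)
Lemma dyadic_sum_le_integral (R : realType) (g : R -> R) (sg : R) (J : nat) :
  0 < sg -> (forall z, 0 < z -> 0 <= g z) ->
  (forall z z', 0 < z -> z <= z' -> g z' <= g z) ->
  ((\sum_(k < J) sg / 2 ^+ k * g (sg / 2 ^+ k))%:E <=
   2%:E * \int[lebesgue_measure]_(z in `]0%R, sg[) (g z)%:E)%E.
Proof.
move=> sg0 g0 gd; pose del k := sg / 2 ^+ k.
have del0 k : 0 < del k by rewrite divr_gt0// exprn_gt0.
have delS k : del k = 2 * del k.+1.
  by rewrite /del exprS invfM; field; rewrite expf_neq0.
pose A k : set R := `]del k.+1, del k[%classic.
pose h L z := \sum_(k < L) g (del k) * \1_(A k) z.
have D0 z : (0 <= ((fun z => (g z)%:E) \_ `]0%R, sg[%classic) z)%E.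
  by apply: erestrict_ge0 => y /=; rewrite in_itv/= lee_fin => /andP[y0 _]; exact: g0.
have del_le k : del k <= sg.
  rewrite /del ler_pdivrMr ?exprn_gt0// ler_peMr//; first exact: ltW.
  by rewrite exprn_ege1// ler1n.
have hz L z : (z < del L -> h L z = 0) /\
    ((h L z)%:E <= ((fun z => (g z)%:E) \_ `]0%R, sg[%classic) z)%E.
  elim: L => [|L [IH1 IH2]]; first by rewrite /h big_ord0; split.
  have AL : h L.+1 z = h L z + g (del L) * \1_(A L) z by rewrite /h big_ord_recr.
  rewrite AL indicE; split=> [zL|].
    rewrite IH1 ?add0r; last by have := del0 L.+1; rewrite (delS L); lra.
    by rewrite memNset ?mulr0// /A/= in_itv/= => /andP[h1 _]; lra.
  have [zL|zL] := ltP z (del L); last first.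
    by rewrite memNset ?mulr0 ?addr0// /A/= in_itv/= => /andP[_ h1]; lra.
  rewrite IH1// add0r; have [zA|zA] := boolP (z \in A L); last by rewrite mulr0.
  move: zA; rewrite inE /A/= in_itv/= mulr1 => /andP[z1 z2].
  have z0 : 0 < z by exact: lt_trans z1.
  rewrite patchE mem_set; last first.
    by rewrite /= in_itv/= z0/=; exact: lt_le_trans (del_le L).
  by rewrite lee_fin gd// ltW.
have mA k : measurable (A k) by exact: measurable_itv.
have h0 L z : 0 <= h L z.
  by apply: sumr_ge0 => k _; rewrite mulr_ge0// g0.
have int_h L : (\int[lebesgue_measure]_z (h L z)%:E =
    (\sum_(k < L) g (del k) * del k.+1)%:E)%E.
  under eq_integral do rewrite -sumEFin.
  rewrite ge0_integral_sum//; last 2 first.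
  - move=> k; apply/measurable_EFinP; apply: measurable_funM.
      exact: measurable_cst.
    by apply: measurable_indic; exact: mA.
  - by move=> k z _; rewrite lee_fin mulr_ge0// g0.
  rewrite -sumEFin; apply: eq_bigr => k _.
  under eq_integral do rewrite EFinM.
  rewrite ge0_integralZl_EFin ?g0//; last first.
    by apply/measurable_EFinP; apply: measurable_indic; exact: mA.
  have ind := @integral_indic _ _ R (@lebesgue_measure R) _ measurableT _ (mA k).
  rewrite setIT in ind; rewrite [X in (_ * X)%E]ind.
  have lm : lebesgue_measure (A k) = (del k.+1)%:E.
    have d1 := del0 k.+1.
    have := @lebesgue_measure_itv R `]del k.+1, del k[%R.
    rewrite /= lte_fin ifT; last by rewrite (delS k); lra.
    by move=> ->; rewrite -EFinB; congr EFin; rewrite (delS k); ring.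
  by rewrite [X in (_ * X)%E]lm -EFinM.
have -> : \sum_(k < J) sg / 2 ^+ k * g (sg / 2 ^+ k) =
    2 * \sum_(k < J) g (del k) * del k.+1.
  rewrite mulr_sumr; apply: eq_bigr => k _.
  by rewrite -/(del k) {1}(delS k); ring.
rewrite EFinM lee_wpmul2l ?lee_fin// -int_h [leRHS]integral_mkcond.
apply: ge0_le_integralT => z; first by rewrite lee_fin.
by have [] := hz J z.
Qed.

Section entropy.
Context (d : measure_display) (T : measurableType d) (R : realType)
  (mu : {measure set T -> \bar R}).
Implicit Types (s t : density mu) (S : set (density mu)) (n : nat).

Definition centered_score n s t : n.-tuple T -> R :=
  centered_sum (density_law s) (fun y => score (t y) (s y)).

(** Brackets of radius [sg / 2 ^ k], pushed through the monotone score, feed the chaining bound.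
    Asking for [gam / 8] where chaining needs [gam / 4] pays for the factor 2 between dyadic sum and
    integral. *)
Lemma entropy_exp_bounded n S s (sg gam Phi : R) (H : R -> R)
    (br : R -> set ((T -> R) * (T -> R))) :
  (0 < n)%N -> S s -> 0 < sg -> 0 < gam -> gam <= 4^-1 ->
  (forall z, 0 < z -> 0 < H z) ->
  (forall z z', 0 < z -> z <= z' -> H z' <= H z) ->
  (forall z, 0 < z ->
      (forall p, br z p ->
         [/\ measurable_fun setT p.1, measurable_fun setT p.2,
             forall x, 0 <= p.1 x & forall x, 0 <= p.2 x]) /\
      (exists N : nat, (br z #= `I_N)%card /\
         ln 2 <= ln N%:R :> R /\ ln N%:R <= H z) /\
      (forall t, S t -> hellinger s t <= sg ->
         exists2 p, br z p &
           (forall x, p.1 x <= t x <= p.2 x) /\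
           (hellinger_sq mu p.2 p.1 <= (z ^+ 2)%:E)%E)) ->
  (\int[lebesgue_measure]_(z in `]0%R, sg[) (Num.sqrt (H z))%:E <= Phi%:E)%E ->
  Phi <= gam / 8 * (Num.sqrt n%:R * sg ^+ 2) ->
  exists W : n.-tuple T -> R, [/\ bounded_mfun W,
    \int[iid_law s n]_x W x <= 1 &
    forall t, S t -> hellinger s t <= sg -> forall x,
      expR ((`|centered_score s t x| - 256 * gam * (n%:R * sg ^+ 2)) / (96 / gam))
        <= W x].
Proof.
move=> n0 Ss sg0 gam0 gam4 H0 Hd Hbr HPhi Phile.
pose I := {t : density mu | S t /\ hellinger s t <= sg}.
have i0 : I by exists s; split=> //; rewrite hellinger_self ltW.
pose del k : R := sg / 2 ^+ k.
have del0 k : 0 < del k by rewrite divr_gt0// exprn_gt0.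
have /choice[Nf HN] (k : nat) : exists q : nat * ((T -> R) * (T -> R) -> nat),
    [/\ set_bij (br (del k)) `I_(q.1) q.2, ln 2 <= ln q.1%:R :> R & ln q.1%:R <= H (del k)].
  have [_ [[N [/card_set_bijP[g bg] [h1 h2]]] _]] := Hbr _ (del0 k).
  by exists (N, g).
have /choice[p0 Hp0] (ki : nat * I) : exists q : (T -> R) * (T -> R),
    [/\ br (del ki.1) q, forall x, q.1 x <= (sval ki.2) x <= q.2 x &
      (hellinger_sq mu q.2 q.1 <= (del ki.1 ^+ 2)%:E)%E].
  case: ki => k [t [St ht]] /=.
  have [_ [_ /(_ _ St ht)[q q1 [q2 q3]]]] := Hbr _ (del0 k).
  by exists q.
pose p k i := p0 (k, i).
have Hp k i : [/\ br (del k) (p k i), forall x, (p k i).1 x <= (sval i) x <= (p k i).2 x &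
      (hellinger_sq mu (p k i).2 (p k i).1 <= (del k ^+ 2)%:E)%E] := Hp0 (k, i).
have Hm k i : [/\ measurable_fun setT (p k i).1, measurable_fun setT (p k i).2,
    forall x, 0 <= (p k i).1 x & forall x, 0 <= (p k i).2 x].
  have [q _ _] := Hp k i; have [h _] := Hbr _ (del0 k); exact: h.
have s0 := density_ge0 s.
have l2 : 0 < ln 2 :> R by rewrite ln_gt0// ltr1n.
(* Cardinalities 0 and 1 both have logarithm 0 (with [ln 0 = 0]), which is below [ln 2]. *)
have N2 k : (2 <= (Nf k).1)%N.
  have [_ h _] := HN k; move: h; case: ((Nf k).1) => [|[|m]]//.
    by rewrite [X in _ <= X]ln0// leNgt l2.
  by rewrite ln1 leNgt l2.
have [] := @bracketing_exp_bounded d T R (density_law s) n I i0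
  (fun i x => score ((sval i) x) (s x))
  (fun k i x => score ((p k i).1 x) (s x))
  (fun k i x => score ((p k i).2 x) (s x))
  (fun k i => (Nf k).2 (p k i)) (fun k => (Nf k).1) sg gam => //.
- by move=> i; have [] := bounded_mfun_score s (density_measurable (sval i)) (density_ge0 (sval i)).
- by move=> k i; have [h1 h2 h3 h4] := Hm k i; have [] := bounded_mfun_score s h1 h3.
- by move=> k i; have [h1 h2 h3 h4] := Hm k i; have [] := bounded_mfun_score s h2 h4.
- by move=> i x; apply: score_le1 => //; exact: density_ge0.
- by move=> k i x; have [_ _ h _] := Hm k i; exact: score_le1.
- by move=> k i x; have [_ _ _ h] := Hm k i; exact: score_le1.
- move=> k i x; have [_ /(_ x)/andP[h1 h2] _] := Hp k i; have [_ _ h3 h4] := Hm k i.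
  by rewrite !score_le// density_ge0.
- move=> k i; have [[h _ _] _ _] := HN k; have [q _ _] := Hp k i; exact: (h _ q).
- move=> k i j e; have [[_ h _] _ _] := HN k.
  have [q _ _] := Hp k i; have [q' _ _] := Hp k j.
  by have -> : p k i = p k j by apply: h; rewrite ?inE.
- move=> i; apply: le_trans (score_second_moment _ _) _.
  case: i => t [St ht] /=; rewrite ler_pM2l// lerXn2r ?nnegrE ?hellinger_ge0//.
  exact: ltW.
- move=> k i; have [_ h1 h2] := Hp k i; have [m1 m2 m3 m4] := Hm k i.
  apply: score_bracket_second_moment => // x.
  by have /andP[a1 a2] := h1 x; exact: le_trans a2.
- move=> J; rewrite -/del.
  have gs0 z : 0 < z -> 0 <= Num.sqrt (H z) by move=> _; exact: sqrtr_ge0.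
  have gsd z z' : 0 < z -> z <= z' -> Num.sqrt (H z') <= Num.sqrt (H z).
    by move=> z0 zz'; apply: ler_wsqrtr; exact: Hd.
  have := dyadic_sum_le_integral J sg0 gs0 gsd.
  have h2 : (2%:E * \int[lebesgue_measure]_(z in `]0%R, sg[) (Num.sqrt (H z))%:E <=
      (2 * Phi)%:E)%E by rewrite EFinM lee_wpmul2l// lee_fin.
  move=> /le_trans/(_ h2); rewrite lee_fin => h.
  apply: (@le_trans _ _ (\sum_(k < J) sg / 2 ^+ k * Num.sqrt (H (sg / 2 ^+ k)))).
    apply: ler_sum => k _; rewrite ler_pM2l ?del0// ler_wsqrtr//.
    by have [_ _] := HN k.
  apply: (le_trans h); lra.
- move=> W [bW W1 WE]; exists W; split=> // t St ht x.
  exact: (WE (exist _ t (conj St ht)) x).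
Qed.

Lemma expectation_iid_tnth n s (g : T -> R) (i : 'I_n) : bounded_mfun g ->
  fine 'E_(iid_law s n)[fun z => g (tnth z i)] = \int[density_law s]_x g x.
Proof.
move=> bg; have [mg [B gB]] := bg.
have bgi : bounded_mfun (fun z : n.-tuple T => g (tnth z i)).
  split; last by exists B.
  by apply: measurableT_comp => //; exact: measurable_tnth.
have -> : fine 'E_(iid_law s n)[fun z => g (tnth z i)] =
    \int[iid_law s n]_z g (tnth z i) by rewrite unlock.
(* Adding [B] makes the function nonnegative, as the product formula requires. *)
apply: (@addIr _ B).
rewrite -[X in _ + X = _](Rintegral_prob_cst (iid_law s n)).
rewrite -[X in _ = _ + X](Rintegral_prob_cst (density_law s)).
have bB : bounded_mfun (fun _ : T => B) by exact: bounded_mfun_cst.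
have bB' : bounded_mfun (fun _ : n.-tuple T => B) by exact: bounded_mfun_cst.
rewrite -!Rintegral_boundedD//; apply: EFin_inj.
rewrite !Rintegral_boundedE; [|exact: bounded_mfunD|exact: bounded_mfunD].
apply: (ge0_integral_prob_pow_tnth (density_law s) i (g := fun x => g x + B)).
  exact: measurable_funD.
by move=> x; have := gB x; rewrite ler_norml => /andP[h _]; lra.
Qed.

Lemma dim_w_le n S s (sg eps c : R) (W : n.-tuple T -> R) :
  (0 < n)%N -> 0 < c -> 0 <= sg -> S s -> bounded_mfun W ->
  \int[iid_law s n]_x W x <= 1 ->
  (forall t, S t -> hellinger s t <= sg -> forall x,
     expR ((`|centered_score s t x| - eps * (n%:R * sg ^+ 2)) / c) <= W x) ->
  (dim_w n S s s (Num.sqrt n%:R * sg) <= (eps * (n%:R * sg ^+ 2))%:E)%E.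
Proof.
move=> n0 c0 sg0 Ss bW W1 HW; set e := eps * _ in HW *.
have nR : 0 < n%:R :> R by rewrite ltr0n.
(* Jensen's inequality in linear form: [1 + x <= expR x] turns the exponential bound into a bound by
   [b], whose mean is at most [e] because [W] has mean at most 1. *)
pose b x := e + c * (W x - 1).
have bb : bounded_mfun b.
  apply: bounded_mfunD; first exact: bounded_mfun_cst.
  apply: bounded_mfunM; first exact: bounded_mfun_cst.
  by apply: bounded_mfunB => //; exact: bounded_mfun_cst.
have Zb t x : S t -> hellinger s t <= sg -> `|centered_score s t x| <= b x.
  move=> St ht; have := le_trans (expR_ge1Dx _) (HW t St ht x).
  rewrite -lerBrDl ler_pdivrMr// /b; lra.
have hs0 : hellinger s s <= sg by rewrite hellinger_self.
have b0 x : 0 <= b x by exact: le_trans (Zb s x Ss hs0).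
apply: (@le_trans _ _ (\int[iid_law s n]_x (b x)%:E)%E).
  (* The integral of a nonnegative function is a supremum over simple minorants, hence monotone also
     for the supremum over the ball, whose measurability is not established. *)
  apply: ge0_le_integralT => x.
    by apply: ereal_sup_ubound; left.
  apply: ge_ereal_sup => y [->|[t [St ht] <-]]; first by rewrite lee_fin.
  move: ht; rewrite hellinger_self expr0n /= mulr0 addr0 exprMn (sqr_sqrtr (ler0n R n)) => ht.
  rewrite lee_fin; move: ht; rewrite ler_pM2l// ler_sqr ?nnegrE ?hellinger_ge0// => ht.
  have bs : bounded_mfun (fun y => score (t y) (s y)).
    by apply: bounded_mfun_score; [exact: density_measurable|exact: density_ge0].
  apply: le_trans (Zb t x St ht); rewrite le_eqVlt; apply/orP; left; apply/eqP.
  congr (`| _ |); rewrite /centered_score /centered_sum sumrB; congr (_ - _).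
    by apply: eq_bigr => i _; rewrite psi_root_ratioE ?density_ge0.
  rewrite (eq_bigr (fun=> \int[density_law s]_x score (t x) (s x))).
    by rewrite sumr_const card_ord mulr_natl.
  move=> i _; rewrite -(expectation_iid_tnth s i bs); congr (fine 'E__[_]).
  by apply/funext => z; rewrite psi_root_ratioE ?density_ge0.
rewrite -Rintegral_boundedE// lee_fin Rintegral_boundedD; [|exact: bounded_mfun_cst|]; last first.
  apply: bounded_mfunM; first exact: bounded_mfun_cst.
  by apply: bounded_mfunB => //; exact: bounded_mfun_cst.
rewrite Rintegral_prob_cst Rintegral_boundedZ; last first.
  by apply: bounded_mfunB => //; exact: bounded_mfun_cst.
rewrite Rintegral_boundedB//; last exact: bounded_mfun_cst.
rewrite Rintegral_prob_cst gerDl pmulr_rle0// subr_le0//.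
Qed.

(* The ball of radius 2 ^ j * sg gets weight 2 ^- j.+1 in V; the resulting loss
   of (j + 1) ln 2 is absorbed by 256 gam n 4 ^ j sg ^ 2. *)
Lemma peeling n S s (sg gam : R) (H : R -> R -> R)
    (br : R -> R -> set ((T -> R) * (T -> R))) (phi : R -> R) :
  (0 < n)%N -> S s -> 0 < sg -> 0 < gam -> gam <= 4^-1 ->
  1 <= 8 / 3 * gam ^+ 2 * (n%:R * sg ^+ 2) ->
  (forall sigma, 0 < sigma ->
    (forall z, 0 < z -> 0 < H sigma z) /\
    (forall z z', 0 < z -> z <= z' -> H sigma z' <= H sigma z) /\
    (forall z, 0 < z ->
      (forall p, br sigma z p ->
         [/\ measurable_fun setT p.1, measurable_fun setT p.2,
             forall x, 0 <= p.1 x & forall x, 0 <= p.2 x]) /\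
      (exists N : nat, (br sigma z #= `I_N)%card /\
         ln 2 <= ln N%:R :> R /\ ln N%:R <= H sigma z) /\
      (forall t, S t -> hellinger s t <= sigma ->
         exists2 p, br sigma z p &
           (forall x, p.1 x <= t x <= p.2 x) /\
           (hellinger_sq mu p.2 p.1 <= (z ^+ 2)%:E)%E))) ->
  (forall sigma, 0 < sigma ->
    (\int[lebesgue_measure]_(z in `]0%R, sigma[) (Num.sqrt (H sigma z))%:E <=
       (phi sigma)%:E)%E) ->
  (forall sigma, sg <= sigma ->
     phi sigma <= gam / 8 * (Num.sqrt n%:R * sigma ^+ 2)) ->
  exists V : n.-tuple T -> R, exists B : R, [/\ measurable_fun setT V,
    forall x, 1 <= V x <= B, \int[iid_law s n]_x V x <= 2 &
    forall t, S t -> forall x, `|centered_score s t x| <=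
      96 / gam * ln (V x) +
      2 * (256 * gam) * (4 * (n%:R * hellinger s t ^+ 2) + n%:R * sg ^+ 2)].
Proof.
move=> n0 Ss sg0 gam0 gam4 hsg Hbr Hphi phile.
have nR : 0 < n%:R :> R by rewrite ltr0n.
pose r j : R := 2 ^+ j * sg.
have r0 j : 0 < r j by rewrite mulr_gt0// exprn_gt0.
have rsg j : sg <= r j.
  by rewrite /r ler_peMl//; [exact: ltW|rewrite exprn_ege1// ler1n].
have /choice[W HW] (j : nat) : exists W : n.-tuple T -> R, [/\ bounded_mfun W,
    \int[iid_law s n]_x W x <= 1 &
    forall t, S t -> hellinger s t <= r j -> forall x,
      expR ((`|centered_score s t x| - 256 * gam * (n%:R * r j ^+ 2)) / (96 / gam))
        <= W x].
  have [h1 [h2 h3]] := Hbr _ (r0 j).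
  exact: (entropy_exp_bounded n0 Ss (r0 j) gam0 gam4 h1 h2 h3 (Hphi _ (r0 j))
    (phile _ (rsg j))).
have W0 j x : 0 <= W j x.
  have [_ _ h] := HW j; apply: le_trans (h s Ss _ x); first exact: expR_ge0.
  by rewrite hellinger_self ltW.
(* Hellinger distances are at most 1, so finitely many balls suffice and [V] stays bounded. *)
have [J hJ] : exists J, 1 <= r J.
  exists (Num.truncn sg^-1).+1; rewrite /r -ler_pdivrMr// mul1r.
  apply: (le_trans (ltW (truncnS_gt _))).
  by rewrite -natrX ler_nat ltnW// ltn_expl.
pose Vs L x := \sum_(j < L) (2 ^+ j.+1)^-1 * W j x.
have bW j : bounded_mfun (fun x => (2 ^+ j.+1)^-1 * W j x).
  by apply: bounded_mfunM; [exact: bounded_mfun_cst|have [] := HW j].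
have bVs L : bounded_mfun (Vs L) by exact: bounded_mfun_sum.
have Vs0 L x : 0 <= Vs L x.
  by apply: sumr_ge0 => j _; rewrite mulr_ge0// invr_ge0 exprn_ge0.
have VsW j L x : (j < L)%N -> (2 ^+ j.+1)^-1 * W j x <= Vs L x.
  move=> jL; rewrite /Vs (bigD1 (Ordinal jL))//= lerDl.
  by apply: sumr_ge0 => i _; rewrite mulr_ge0// invr_ge0 exprn_ge0.
have intVs L : \int[iid_law s n]_x Vs L x <= 1 - (2 ^+ L)^-1.
  elim: L => [|L IH].
    rewrite expr0 invr1 subrr /Vs; under eq_Rintegral do rewrite big_ord0.
    by rewrite Rintegral_prob_cst.
  have -> : \int[iid_law s n]_x Vs L.+1 x =
      \int[iid_law s n]_x (Vs L x + (2 ^+ L.+1)^-1 * W L x).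
    by apply: eq_Rintegral => x _; rewrite /Vs big_ord_recr.
  have [bWL WL _] := HW L.
  rewrite Rintegral_boundedD// Rintegral_boundedZ//.
  have : (2 ^+ L.+1)^-1 * \int[iid_law s n]_x W L x <= (2 ^+ L.+1)^-1 * 1 :> R.
    by rewrite ler_wpM2l// invr_ge0 exprn_ge0.
  have : (2 ^+ L)^-1 = 2 * (2 ^+ L.+1)^-1 :> R.
    by rewrite exprS invfM mulrA mulfV// mul1r.
  lra.
have [mV [B VB]] := bVs J.+1.
(* The summand 1 secures [V >= 1] for the entropy inequality and raises the mean to at most 2. *)
exists (fun x => 1 + Vs J.+1 x), (1 + B); split.
- by apply: measurable_funD => //; exact: measurable_cst.
- move=> x; rewrite lerDl Vs0 lerD2l.
  exact: le_trans (ler_norm _) (VB x).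
- rewrite Rintegral_boundedD//; last exact: bounded_mfun_cst.
  rewrite Rintegral_prob_cst; have := intVs J.+1.
  have : 0 <= (2 ^+ J.+1)^-1 :> R by rewrite invr_ge0 exprn_ge0.
  lra.
- move=> t St x.
  have hJt : hellinger s t <= r J.
    apply: le_trans hJ; have := hellinger_sqr_le1 s t.
    by rewrite -[X in _ <= X](expr1n _ 2) ler_sqr ?nnegrE ?hellinger_ge0.
  have exj : exists j, hellinger s t <= r j by exists J.
  pose j := ex_minn exj.
  (* For the smallest ball containing [t], either [j = 0] and its radius is [sg], or the preceding
     radius is at most the distance, so that [r j] is at most twice the distance. *)
  have [jJ hj rj] : [/\ (j < J.+1)%N, hellinger s t <= r j &
      r j ^+ 2 <= 4 * hellinger s t ^+ 2 + sg ^+ 2].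
    rewrite /j; case: ex_minnP => i hi imin; split=> //.
      by rewrite ltnS; exact: imin.
    case: i hi imin => [|i] hi imin.
      by rewrite /r expr0 mul1r lerDr mulr_ge0// sqr_ge0.
    have hi' : r i <= hellinger s t.
      by rewrite leNgt; apply/negP => /ltW /imin; rewrite ltnn.
    have -> : r i.+1 ^+ 2 = 4 * r i ^+ 2.
      by rewrite (_ : r i.+1 = 2 * r i); [ring|rewrite /r exprS mulrA].
    have : r i ^+ 2 <= hellinger s t ^+ 2.
      by rewrite lerXn2r ?nnegrE ?hellinger_ge0// ltW.
    have := sqr_ge0 sg; lra.
  have [_ _ /(_ t St hj x) hW] := HW j.
  set e := 256 * gam * (n%:R * r j ^+ 2) in hW.
  set z := `|centered_score s t x| in hW *.
  have c0 : 0 < 96 / gam by rewrite divr_gt0.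
  have V0 : 0 < 1 + Vs J.+1 x by rewrite ltr_wpDr.
  have hV : W j x <= expR j.+1%:R * (1 + Vs J.+1 x).
    have e2 : 2 ^+ j.+1 <= expR j.+1%:R :> R.
      rewrite -[j.+1%:R]mulr1 expRM_natl lerXn2r ?nnegrE ?expR_ge0//.
      by have := expR_ge1Dx (1 : R); lra.
    have p2 : 0 < 2 ^+ j.+1 :> R by rewrite exprn_gt0.
    apply: (@le_trans _ _ (2 ^+ j.+1 * (1 + Vs J.+1 x))); last by rewrite ler_pM2r.
    have := VsW j J.+1 x jJ; rewrite mulrC ler_pdivrMr// => h.
    by rewrite (le_trans h)// [leRHS]mulrC ler_pM2r// lerDr.
  have := le_trans hW hV.
  rewrite -[1 + Vs J.+1 x]lnK ?posrE// -expRD ler_expR ler_pdivrMr//.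
  rewrite expRK.
  (* Follows from [j + 1 <= 4 ^ j] and the lower bound on [n * sg ^ 2], whose constant is
     [8 / 3 = 256 / 96]. *)
  have ej : j.+1%:R * (96 / gam) <= e.
    rewrite mulrA ler_pdivrMr//.
    have k4 : j.+1%:R <= 4 ^+ j :> R.
      rewrite -natrX ler_nat; elim: (j) => [//|i IH].
      rewrite expnS (@leq_trans (2 * i.+1)%N) ?leq_mul//.
      by rewrite mulnS -(add2n i) leq_add2l leq_pmull.
    have -> : e * gam = 96 * (4 ^+ j * (8 / 3 * gam ^+ 2 * (n%:R * sg ^+ 2))).
      rewrite /e /r exprMn -exprM muln2 -mul2n exprM.
      have -> : 2 ^+ 2 = 4 :> R by ring.
      by move: (4 ^+ j) => q; field.
    rewrite mulrC ler_pM2l//; apply: (le_trans k4).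
    by rewrite ler_peMr// exprn_ge0.
  have en : e <= 256 * gam * (4 * (n%:R * hellinger s t ^+ 2) + n%:R * sg ^+ 2).
    rewrite /e ler_pM2l; last by rewrite mulr_gt0.
    by have := ler_wpM2l (ltW nR) rj; lra.
  lra.
Qed.

End entropy.

(** * Risk of rho-estimators *)

(** Monotonicity of [phi x / x] propagates the inequality: some [a < al * sigma] in the set gives
    [phi sigma / sigma <= phi a / a <= rn * a <= al * rn * sigma]. Strictness in [tau / al < sigma]
    supplies [a], since the infimum need not be attained. *)
Lemma critical_radius (R : realType) (phi : R -> R) (rn al : R) :
  0 < rn -> 0 < al -> al <= 1 ->
  (forall x, 0 < x -> 0 < phi x) ->
  (forall x y, 0 < x -> x <= y -> phi y / y <= phi x / x) ->
  let tau := inf [set sigma | 0 < sigma /\ phi sigma <= rn * sigma ^+ 2] in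
  0 <= tau /\
  forall sigma, tau / al < sigma -> phi sigma <= al * (rn * sigma ^+ 2).
Proof.
move=> rn0 al0 al1 phi0 phid tau.
set A := [set sigma | _] in tau *.
have A0 : A !=set0.
  exists (Num.max 1 (phi 1 / rn)); set m := Num.max _ _.
  have m1 : 1 <= m by rewrite le_max lexx.
  have m0 : 0 < m by exact: lt_le_trans m1.
  split=> //; have := phid 1 m ltr01 m1; rewrite divr1 ler_pdivrMr// => h.
  apply: (le_trans h); rewrite expr2 mulrA ler_pM2r//.
  by rewrite mulrC -ler_pdivrMr// le_max lexx orbT.
have lbA : lbound A 0 by move=> a [/ltW].
have tau0 : 0 <= tau by exact: lb_le_inf.
split=> // sigma; rewrite ltr_pdivrMr// => ts.
have [a [a0 pa] aS] := inf_lt A0 ts.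
have s0 : 0 < sigma by rewrite -(pmulr_lgt0 _ al0) (lt_trans a0).
have as_ : a <= sigma by rewrite (le_trans (ltW aS))// ler_piMr// ltW.
have := phid a sigma a0 as_; rewrite ler_pdivrMr// => h; apply: (le_trans h).
have h2 : phi a / a <= rn * a by rewrite ler_pdivrMr// -mulrA -expr2.
apply: (@le_trans _ _ (rn * (sigma * al) * sigma)).
  rewrite ler_pM2r// (le_trans h2)// ler_pM2l// ltW//.
by rewrite le_eqVlt; apply/orP; left; apply/eqP; ring.
Qed.

Section rho_estimators.
Context (d : measure_display) (T : measurableType d) (R : realType)
  (mu : {measure set T -> \bar R}).
Implicit Types (s t u : density mu) (S : set (density mu)) (n : nat).

Lemma hellinger_sqrC s t : hellinger s t ^+ 2 = hellinger t s ^+ 2.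
Proof.
rewrite !hellinger_sqrE; congr (_ * _); apply: eq_Rintegral => x _.
by rewrite -sqrrN opprB.
Qed.

(** The drift [4^-1] minus [8 * e <= 8^-1] leaves [8^-1]. For [t] in the set, [- T(s, t) = T(t, s)]
    is at most [b + kappa / 10], yet at least [n h ^ 2 / 8 - b]; hence [16 * b + 286], where 286
    rounds up [8 * 35.7]. Passing to the closure doubles this and adds 2. *)
Lemma rho_set_hellinger_le n S s (x : n.-tuple T) (Z e m : R) u :
  (0 < n)%N -> S s -> 0 <= e -> e <= 64^-1 ->
  (forall t, S t -> `|centered_score s t x| <=
     Z + 2 * e * (4 * (n%:R * hellinger s t ^+ 2) + m)) ->
  hellinger_closure (rho_set x S) u ->
  n%:R * hellinger s u ^+ 2 <= 32 * (Z + 2 * e * m) + 574.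
Proof.
move=> n0 Ss e0 e64 HZ Hu; have nR : 0 < n%:R :> R by rewrite ltr0n.
pose b := Z + 2 * e * m.
have hT t : S t -> Tstat x s t <= b - 8^-1 * (n%:R * hellinger s t ^+ 2).
  move=> St; apply: (le_trans (Tstat_le x s t)); rewrite -/(centered_score s t x).
  have q1 : (Num.sqrt 2)^-1 <= 1 :> R.
    by rewrite invf_le1 ?sqrtr_gt0// -{1}sqrtr1 ler_sqrt// ler1n.
  have q0 : 0 <= (Num.sqrt 2)^-1 :> R by rewrite invr_ge0.
  have h1 : (Num.sqrt 2)^-1 * centered_score s t x <= `|centered_score s t x|.
    apply: (@le_trans _ _ ((Num.sqrt 2)^-1 * `|centered_score s t x|)).
      by rewrite ler_wpM2l// ler_norm.
    by rewrite ler_piMl.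
  have h2 := HZ t St.
  have h0 : 0 <= n%:R * hellinger s t ^+ 2 by rewrite mulr_ge0// sqr_ge0.
  have := ler_wpM2r h0 e64; rewrite /b; lra.
have Ups : (Upsilon x S s <= b%:E)%E.
  apply: ge_ereal_sup => _ [t St <-]; rewrite lee_fin (le_trans (hT t St))//.
  by rewrite lerBlDr lerDl mulr_ge0// mulr_ge0// sqr_ge0.
have inS t : rho_set x S t -> n%:R * hellinger s t ^+ 2 <= 16 * b + 286.
  move=> [St]; move=> Ut.
  have h1 : ((Tstat x t s)%:E <= Upsilon x S t)%E.
    by apply: ereal_sup_ubound; exists s.
  have h2 : (ereal_inf [set Upsilon x S v | v in S] <= b%:E)%E.
    by apply: le_trans Ups; apply: ereal_inf_lbound; exists s.
  have h3 : ((Tstat x t s)%:E <= b%:E + (kappa R / 10)%:E)%E.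
    by apply: le_trans h1 _; apply: (le_trans Ut); rewrite leeD2r.
  move: h3; rewrite -EFinD lee_fin TstatC /kappa; have := hT t St; lra.
have e1 : 0 < n.+1%:R^-1 :> R by rewrite invr_gt0.
have [t tS ut] := Hu _ e1.
have := hellinger_sqr_triangle s t u; rewrite (hellinger_sqrC t u) => tri.
have h4 := inS t tS.
have h5 : n%:R * hellinger u t ^+ 2 <= 1.
  have : hellinger u t ^+ 2 <= n.+1%:R^-1 ^+ 2.
    by rewrite lerXn2r ?nnegrE ?hellinger_ge0 ?ltW.
  move=> /(ler_wpM2l (ltW nR)) h; apply: (le_trans h).
  rewrite exprVn ler_pdivrMr ?exprn_gt0// mul1r -natrX ler_nat.
  by rewrite -mulnn mulSn (leq_trans (leqnSn n))// leq_addr.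
have := ler_wpM2l (ltW nR) tri; rewrite /b in h4 *; lra.
Qed.

End rho_estimators.

(** * Transfer to the true law and conclusion *)

Section risk.
Context (d : measure_display) (T : measurableType d) (R : realType)
  (mu : {measure set T -> \bar R}).
Implicit Types (s t u : density mu) (S : set (density mu)).

Lemma iid_entropy_ineq n s t (V : n.-tuple T -> R) B :
  (kullback s t < +oo)%E -> measurable_fun setT V ->
  (forall x, 1 <= V x <= B) ->
  \int[iid_law s n]_x ln (V x) <=
    fine (kullback s t) *+ n + ln (\int[iid_law t n]_x V x).
Proof.
move=> K mV VB.
have blnV : bounded_mfun (fun x => ln (V x)) by exact: bounded_mfun_ln VB.
rewrite -lee_fin Rintegral_boundedE//.
apply: entropy_ineq_prob_pow VB => // U C mU UC.
by rewrite (kullbackE K); exact: donsker_varadhan UC.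
Qed.

(** The squared distance from [s] is split at [t]: the first half is paid by the divergence, the
    second is affine in [ln V] and is transferred by the entropy inequality. The factor [n] in the
    divergence of the product laws cancels against the [1 / n] in front of [ln V]. *)
Lemma rho_estimator_risk_le n S s t (c e m : R) (V : n.-tuple T -> R) B
    (shat : n.-tuple T -> density mu) :
  (0 < n)%N -> S t -> 0 <= c -> 0 <= e -> e <= 64^-1 ->
  (kullback s t < +oo)%E -> measurable_fun setT V ->
  (forall x, 1 <= V x <= B) -> \int[iid_law t n]_x V x <= 2 ->
  (forall u, S u -> forall x, `|centered_score t u x| <=
     c * ln (V x) + 2 * e * (4 * (n%:R * hellinger t u ^+ 2) + n%:R * m)) ->
  rho_estimator S shat ->
  \int[iid_law s n]_x (hellinger s (shat x) ^+ 2) <=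
    (1 + 64 * c) * fine (kullback s t) + (64 * c + 1148) / n%:R + 128 * (e * m).
Proof.
move=> n0 St c0 e0 e64 K mV VB V2 HZ [mshat Hshat].
have nR : 0 < n%:R :> R by rewrite ltr0n.
have V1 x : 1 <= V x by have /andP[] := VB x.
have blnV : bounded_mfun (fun x => ln (V x)) by exact: bounded_mfun_ln VB.
have bh : bounded_mfun (fun x => hellinger s (shat x) ^+ 2).
  apply: (bounded_mfun_itv (a := 0) (b := 1)); first exact: measurable_funX.
  by move=> x; rewrite sqr_ge0 hellinger_sqr_le1.
pose A := 2 * hellinger s t ^+ 2 + 1148 / n%:R + 128 * (e * m).
have pw x : hellinger s (shat x) ^+ 2 <= A + (64 * c / n%:R) * ln (V x).
  have h := rho_set_hellinger_le n0 St e0 e64 (fun u Su => HZ u Su x) (Hshat x).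
  have tri := hellinger_sqr_triangle s t (shat x).
  have h2 : hellinger t (shat x) ^+ 2 <=
      (32 * (c * ln (V x) + 2 * e * (n%:R * m)) + 574) / n%:R.
    by rewrite ler_pdivlMr// mulrC.
  have E : (32 * (c * ln (V x) + 2 * e * (n%:R * m)) + 574) / n%:R =
      (32 * c / n%:R) * ln (V x) + 64 * (e * m) + 574 / n%:R.
    by field; rewrite gt_eqF.
  rewrite /A; rewrite E in h2; lra.
have bc r : bounded_mfun (fun _ : n.-tuple T => r : R) by exact: bounded_mfun_cst.
apply: (@le_trans _ _ (\int[iid_law s n]_x (A + (64 * c / n%:R) * ln (V x)))).
  apply: le_Rintegral_bounded => //; apply: bounded_mfunD => //.
  exact: bounded_mfunM.
rewrite Rintegral_boundedD//; last exact: bounded_mfunM.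
rewrite Rintegral_prob_cst Rintegral_boundedZ//.
have h := iid_entropy_ineq K mV VB.
have l2 : ln (\int[iid_law t n]_x V x) <= 1.
  have p1 : 1 <= \int[iid_law t n]_x V x.
    rewrite -[1](Rintegral_prob_cst (iid_law t n)).
    by apply: le_Rintegral_bounded => //; exact: bounded_mfun_itv VB.
  have := ln_le_subr1 (lt_le_trans ltr01 p1); lra.
have cn : 0 <= 64 * c / n%:R by rewrite divr_ge0// mulr_ge0.
have := ler_wpM2l cn (le_trans h (lerD (lexx _) l2)).
have -> : 64 * c / n%:R * (fine (kullback s t) *+ n + 1) =
    64 * c * fine (kullback s t) + 64 * c / n%:R.
  by rewrite -mulr_natr; field; rewrite gt_eqF.
have hk := hellinger_sqr_le_kullback K.
have -> : fine (kullback s t) = \int[mu]_x (s x * ln (s x / t x)).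
  by rewrite (kullbackE K).
rewrite /A mulrDl; move: hk; lra.
Qed.

End risk.

Lemma le_mulr_addr3 (R : realDomainType) (a b g k m v L : R) :
  0 <= a -> 0 <= b -> 0 <= g -> 0 <= k -> 0 <= m -> v <= m ->
  L <= b * k + a * v + g * m -> L <= (k + m) * (a + g + b).
Proof.
move=> a0 b0 g0 k0 m0 vm hL.
have := ler_wpM2l a0 vm; have := mulr_ge0 a0 k0; have := mulr_ge0 g0 k0.
have := mulr_ge0 b0 m0; lra.
Qed.

Theorem theorem22 (R : realType) :
  exists C C' : R, 0 < C /\ 0 < C' /\
  forall (n : nat) (d : measure_display) (T : measurableType d)
    (mu : {measure set T -> \bar R}) (Sbar S : set (density mu))
    (H : density mu -> R -> R -> R)
    (brackets : density mu -> R -> R -> set ((T -> R) * (T -> R)))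
    (phi : R -> R),
  (3 <= n)%N ->
  is_model Sbar ->
  S `<=` Sbar -> countable S -> identifiable S ->
  (forall s : density mu, kullback_set s S = kullback_set s Sbar) ->
  (forall (sigma : R) (sbar : density mu), 0 < sigma -> S sbar ->
    (forall z : R, 0 < z -> 0 < H sbar sigma z) /\
    (forall z z' : R, 0 < z -> z <= z' -> H sbar sigma z' <= H sbar sigma z) /\
    (forall z : R, 0 < z ->
      (forall p, brackets sbar sigma z p ->
         [/\ measurable_fun setT p.1, measurable_fun setT p.2,
             forall x, 0 <= p.1 x & forall x, 0 <= p.2 x]) /\
      (exists N : nat, (brackets sbar sigma z #= `I_N)%card /\
         ln 2 <= ln N%:R :> R /\ ln N%:R <= H sbar sigma z) /\
      (forall t : density mu, S t -> hellinger sbar t <= sigma ->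
         exists2 p, brackets sbar sigma z p &
           (forall x, p.1 x <= t x <= p.2 x) /\
           (hellinger_sq mu p.2 p.1 <= (z ^+ 2)%:E)%E))) ->
  (forall x : R, 0 < x -> 0 < phi x) ->
  (forall x y : R, 0 < x -> x <= y -> phi x <= phi y) ->
  (forall x y : R, 0 < x -> x <= y -> phi y / y <= phi x / x) ->
  (forall sigma : R, 0 < sigma ->
    (nnsup [set \int[lebesgue_measure]_(z in `]0%R, sigma[)
                 (Num.sqrt (H sbar sigma z))%:E | sbar in S]
       <= (phi sigma)%:E)%E) ->
  let tau := inf [set sigma : R |
                   0 < sigma /\ phi sigma <= Num.sqrt n%:R * sigma ^+ 2] in
  (nnsup [set rho_dim n S sbar sbar | sbar in S]
     <= maxe (C * n%:R * tau ^+ 2)%:E 1)%E /\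
  forall (s : density mu)
    (dO : measure_display) (Omega : measurableType dO)
    (P : probability Omega R) (X : 'I_n -> {RV P >-> T})
    (shat : n.-tuple T -> density mu),
  is_iid_sample X s ->
  rho_estimator S shat ->
  (C'%:E * 'E_P[fun w => (hellinger s (shat [tuple X i w | i < n]) ^+ 2)%R]
     <= kullback_set s Sbar + (Num.max (tau ^+ 2) (n%:R^-1))%:E)%E.
Proof.
(* Makes the chaining level [256 * gam] equal to [64^-1]: small enough for [rho_set_hellinger_le],
   and at most [c0] because [1 / sqrt 2 <= 7 / 8]. *)
pose gam : R := (256 * 64)^-1.
have gam0 : 0 < gam by rewrite invr_gt0 mulr_gt0.
have gam64 : 256 * gam = 64^-1 by rewrite /gam invfM mulrA mulfV ?mul1r.
have gam4 : gam <= 4^-1 by lra.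
pose al := gam / 8.
have al0 : 0 < al by rewrite divr_gt0.
have al1 : al <= 1 by rewrite /al; lra.
have c0le : 64^-1 <= c0 R.
  rewrite /c0; have q0 : 0 < Num.sqrt 2 :> R by rewrite sqrtr_gt0.
  have : (Num.sqrt 2)^-1 <= 7 / 8 :> R.
    rewrite -[leRHS]invrK lef_pV2 ?posrE//.
    rewrite -ler_sqr ?nnegrE ?ltW// sqr_sqrtr//; lra.
  lra.
pose cc := 96 / gam.
have cc0 : 0 < cc by rewrite divr_gt0.
(* The coefficients of [1 / n], of [m] and of the divergence in the risk bound, added up. *)
pose K := (64 * cc + 1148) + 128 * (256 * gam * (2 / al) ^+ 2) + (1 + 64 * cc).
have K0 : 0 < K.
  have : 0 <= (2 / al) ^+ 2 by exact: sqr_ge0.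
  by rewrite /K gam64; lra.
exists (al ^- 2), K^-1; split; first by rewrite invr_gt0 exprn_gt0.
split; first by rewrite invr_gt0.
move=> n d T mu Sbar S H br phi n3 _ _ _ _ KS Hbr phi0 _ phid Hphi tau.
have n0 : (0 < n)%N by exact: leq_trans n3.
have nR : 0 < n%:R :> R by rewrite ltr0n.
have rn0 : 0 < Num.sqrt n%:R :> R by rewrite sqrtr_gt0.
have [tau0 crit] := critical_radius rn0 al0 al1 phi0 phid.
rewrite -/tau in tau0 crit.
have Hint t sg : S t -> 0 < sg ->
    (\int[lebesgue_measure]_(z in `]0%R, sg[) (Num.sqrt (H t sg z))%:E <= (phi sg)%:E)%E.
  by move=> St sg0; apply: le_trans (Hphi sg sg0); apply: ereal_sup_ubound; right; exists t.
split.
  apply: ge_ereal_sup => _ [->|[t St <-]]; first by rewrite le_max lee01 orbT.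
  rewrite /rho_dim ge_max; apply/andP; split; last by rewrite le_max lexx orbT.
  rewrite le_max; apply/orP; left.
  (* Beyond [M] the radius [y / sqrt n] exceeds [tau / al], and chaining contradicts the inequality
     defining [dim_ybar]. The square of [M] is the origin of [C = al ^- 2]. *)
  set M := Num.sqrt n%:R * (tau / al).
  have M0 : 0 <= M by rewrite mulr_ge0// divr_ge0// ltW.
  have yM : (dim_ybar n S t t <= M%:E)%E.
    apply: ge_ereal_sup => _ [->|[y [y0 wy] <-]]; first by rewrite lee_fin.
    rewrite lee_fin leNgt; apply/negP => My.
    have [sg ysg] : exists sg, y = Num.sqrt n%:R * sg.
      by exists (y / Num.sqrt n%:R); rewrite mulrCA mulfV ?mulr1// gt_eqF.
    have tsg : tau / al < sg by move: My; rewrite ysg /M ltr_pM2l.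
    have sg0 : 0 < sg by apply: le_lt_trans tsg; rewrite divr_ge0// ltW.
    have [h1 [h2 h3]] := Hbr sg t sg0 St.
    have [W [bW W1 HW]] := entropy_exp_bounded n0 St sg0 gam0 gam4 h1 h2 h3
      (Hint t sg St sg0) (crit sg tsg).
    have := dim_w_le n0 cc0 (ltW sg0) St bW W1 HW.
    rewrite -ysg leNgt => /negP; apply; apply: le_lt_trans wy.
    rewrite lee_fin ysg exprMn sqr_sqrtr// gam64 ler_wpM2r//.
    by rewrite mulr_ge0// sqr_ge0.
  have y0 : (0 <= dim_ybar n S t t)%E by apply: ereal_sup_ubound; left.
  move: yM y0; case: (dim_ybar n S t t) => [r| |]//.
  rewrite !lee_fin => rM r0; rewrite -[X in X <= _]/(r ^+ 2).
  have -> : al ^- 2 * n%:R * tau ^+ 2 = M ^+ 2.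
    by rewrite /M [RHS]exprMn (sqr_sqrtr (ltW nR)) [(tau / al) ^+ 2]exprMn exprVn; ring.
  by rewrite lerXn2r ?nnegrE.
move=> s dO Om P X shat Xs rho.
set m := Num.max _ _.
have m0 : 0 < m by rewrite lt_max invr_gt0 nR orbT.
have [mh _] := rho.
have -> : ('E_P[fun w => (hellinger s (shat [tuple X i w | i < n]) ^+ 2)%R] =
    (\int[iid_law s n]_x (hellinger s (shat x) ^+ 2))%:E)%E.
  rewrite (ge0_integral_sample Xs (F := fun x => hellinger s (shat x) ^+ 2)).
  - rewrite Rintegral_boundedE//.
    apply: (bounded_mfun_itv (a := 0) (b := 1)); first exact: measurable_funX.
    by move=> x; rewrite sqr_ge0 hellinger_sqr_le1.
  - exact: measurable_funX.
  - by move=> x; exact: sqr_ge0.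
(* With [m] moved to the left, the infimum can be bounded below element by element, although it need
   not be attained. Hypothesis (i) enters here, to restrict to elements of [S]. *)
rewrite -EFinM -leeBlDr// -EFinB -KS; apply: le_ereal_inf_tmp => _ [t St <-].
have [Kt|] := ltP (kullback s t) +oo%E; last by rewrite leye_eq => /eqP ->; rewrite leey.
rewrite (kullbackE Kt).
(* The factor 2 makes [tau / al < sg] strict, and [m >= 1 / n] makes [n * sg ^ 2] large enough for
   peeling even when [tau] is tiny. *)
pose sg := 2 / al * Num.sqrt m.
have sg0 : 0 < sg by rewrite mulr_gt0 ?divr_gt0// sqrtr_gt0.
have sg2 : sg ^+ 2 = (2 / al) ^+ 2 * m by rewrite /sg exprMn sqr_sqrtr// ltW.
have tausg : tau / al < sg.
  have tm : tau <= Num.sqrt m.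
    by rewrite -(ger0_norm tau0) -sqrtr_sqr ler_wsqrtr// le_max lexx.
  have sm : 0 < Num.sqrt m by rewrite sqrtr_gt0.
  rewrite ltr_pdivrMr// (_ : sg * al = 2 * Num.sqrt m); first lra.
  by rewrite /sg; field; rewrite gt_eqF.

have nm : 1 <= n%:R * m.
  by rewrite mulrC -ler_pdivrMr// mul1r le_max lexx orbT.
have hsg : 1 <= 8 / 3 * gam ^+ 2 * (n%:R * sg ^+ 2).
  have -> : 8 / 3 * gam ^+ 2 * (n%:R * sg ^+ 2) = 2048 / 3 * (n%:R * m).
    by rewrite sg2 /al; field; rewrite gt_eqF.
  lra.
have crit' sigma : sg <= sigma -> phi sigma <= gam / 8 * (Num.sqrt n%:R * sigma ^+ 2).
  by move=> h; apply: crit; exact: lt_le_trans h.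
have [V [B [mV VB V2 HV]]] := peeling n0 St sg0 gam0 gam4 hsg
  (fun sigma h => Hbr sigma t h St) (fun sigma h => Hint t sigma St h) crit'.
have e0 : 0 <= 256 * gam by rewrite gam64 invr_ge0.
have e64 : 256 * gam <= 64^-1 by rewrite gam64.
have := rho_estimator_risk_le n0 St (ltW cc0) e0 e64 Kt mV VB V2 HV rho.
rewrite (kullbackE Kt) /= sg2.
set L := \int[iid_law s n]_x _; set k := \int[mu]_x _ => hL.
have k0 : 0 <= k.
  by apply: le_trans (hellinger_sqr_le_kullback Kt); rewrite mulr_ge0// sqr_ge0.
have nV : n%:R^-1 <= m by rewrite le_max lexx orbT.
rewrite lee_fin lerBlDr mulrC ler_pdivrMr//.
have c64 : 0 <= 64 * cc by rewrite mulr_ge0// ltW.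
have a0 : 0 <= 64 * cc + 1148 := addr_ge0 c64 (ler0n R 1148).
have b0 : 0 <= 1 + 64 * cc := addr_ge0 ler01 c64.
have g0 : 0 <= 128 * (256 * gam * (2 / al) ^+ 2).
  by rewrite mulr_ge0 ?ler0n// mulr_ge0 ?sqr_ge0.
have hL' : L <= (1 + 64 * cc) * k + (64 * cc + 1148) / n%:R +
    128 * (256 * gam * (2 / al) ^+ 2) * m.
  by move: hL; rewrite -[128 * _ * m]mulrA -[256 * gam * (2 / al) ^+ 2 * m]mulrA.
exact: (le_mulr_addr3 a0 b0 g0 k0 (ltW m0) nV hL').
Qed.
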